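(* Let $\mathcal{L}$ be a continuous signature (possibly with a metric) and let $\Gamma\subseteq\mathrm{For}(\mathcal{L})$ be consistent. Then there are a continuous signature $\mathcal{L}^c\supseteq\mathcal{L}$, a maximal consistent and Henkin complete set $\Delta\subseteq\mathrm{For}(\mathcal{L}^c)$ with $\Delta\supseteq\Gamma$, a continuous $\mathcal{L}^c$-pre-structure $\mathfrak{M}$, and an $\mathfrak{M}$-assignment $\sigma$ such that $(\mathfrak{M},\sigma)\models_Q\Delta$.
   Context: Continuous signatures. A continuous signature $\mathcal{L}$: a nonempty set $\mathcal{R}$ of relation symbols, a set $\mathcal{F}$ of function symbols disjoint from $\mathcal{R}$ (0-ary ones are constant symbols), arities $n_s<\omega$, and functions $\delta_{s,i}:(0,1]\to(0,1]$ for $i<n_s$; a signature with a metric has a distinguished binary relation symbol $d\in\mathcal{R}$. Syntax. Formulae: $Pt_0\cdots t_{n_P-1}$, $\varphi\mathbin{\dot{-}}\psi$, $\neg\varphi$, $\tfrac12\varphi$, $\sup_x\varphi$. Abbreviations: $\varphi\wedge\psi:=\varphi\mathbin{\dot{-}}(\varphi\mathbin{\dot{-}}\psi)$, $1:=\neg(\varphi\mathbin{\dot{-}}\varphi)$, $2^{-n}:=\tfrac12\cdots\tfrac12 1$; $\mathbb{D}$ is the set of dyadic rationals in $[0,1]$, each identified with a closed formula built from $1$ by $\neg,\mathbin{\dot{-}},\tfrac12$ denoting it. $\varphi[t/x]$: free substitution, correct if no variable of $t$ becomes bound. Semantics. A continuous $\mathcal{L}$-pre-structure: nonempty $M$, $f^{\mathfrak{M}}:M^{n_f}\to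 M$, $P^{\mathfrak{M}}:M^{n_P}\to[0,1]$; with a metric, $d^{\mathfrak{M}}$ is a $[0,1]$-valued pseudometric and for $|\bar a|=i$, $\epsilon\in(0,1]$: $d^{\mathfrak{M}}(c,e)<\delta_{f,i}(\epsilon)\Rightarrow d^{\mathfrak{M}}(f^{\mathfrak{M}}(\bar a,c,\bar b),f^{\mathfrak{M}}(\bar a,e,\bar b))\le\epsilon$ and $d^{\mathfrak{M}}(c,e)<\delta_{P,i}(\epsilon)\Rightarrow\max(P^{\mathfrak{M}}(\bar a,c,\bar b)-P^{\mathfrak{M}}(\bar a,e,\bar b),0)\le\epsilon$. An $\mathfrak{M}$-assignment is $\sigma:V\to M$. Values: atomic via $P^{\mathfrak{M}}$; $\mathfrak{M}(\alpha\mathbin{\dot{-}}\beta,\sigma)=\max(\mathfrak{M}(\alpha,\sigma)-\mathfrak{M}(\beta,\sigma),0)$; $\neg$: $1-$; $\tfrac12$: half; $\mathfrak{M}(\sup_x\alpha,\sigma)=\sup_{a\in M}\mathfrak{M}(\alpha,\sigma^a_x)$. $(\mathfrak{M},\sigma)\models_Q\Delta$ iff every formula of $\Delta$ has value $0$. Proof system. Axioms: all generalizations $\sup_{x_1}\cdots\sup_{x_n}\chi$ ($n\ge0$) of instances of (A1) $(\varphi\mathbin{\dot{-}}\psi)\mathbin{\dot{-}}\varphi$; (A2) $((\chi\mathbin{\dot{-}}\varphi)\mathbin{\dot{-}}(\chi\mathbin{\dot{-}}\psi))\mathbin{\dot{-}}(\psi\mathbin{\dot{-}}\varphi)$; (A3)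 $(\varphi\mathbin{\dot{-}}(\varphi\mathbin{\dot{-}}\psi))\mathbin{\dot{-}}(\psi\mathbin{\dot{-}}(\psi\mathbin{\dot{-}}\varphi))$; (A4) $(\varphi\mathbin{\dot{-}}\psi)\mathbin{\dot{-}}(\neg\psi\mathbin{\dot{-}}\neg\varphi)$; (A5) $\tfrac12\varphi\mathbin{\dot{-}}(\varphi\mathbin{\dot{-}}\tfrac12\varphi)$; (A6) $(\varphi\mathbin{\dot{-}}\tfrac12\varphi)\mathbin{\dot{-}}\tfrac12\varphi$; (A7) $(\sup_x\psi\mathbin{\dot{-}}\sup_x\varphi)\mathbin{\dot{-}}\sup_x(\psi\mathbin{\dot{-}}\varphi)$; (A8) $\varphi[t/x]\mathbin{\dot{-}}\sup_x\varphi$ (correct substitution); (A9) $\sup_x\varphi\mathbin{\dot{-}}\varphi$ ($x$ not free in $\varphi$); with a metric also (A10) $dxx$; (A11) $dxy\mathbin{\dot{-}}dyx$; (A12) $(dxz\mathbin{\dot{-}}dxy)\mathbin{\dot{-}}dyz$; (A13) $(q\mathbin{\dot{-}}dzw)\wedge(d\,f\bar xz\bar y\,f\bar xw\bar y\mathbin{\dot{-}}r)$ for $f\in\mathcal{F}$, $|\bar x|=i<n_f$, $\epsilon\in(0,1]$, $r,q\in\mathbb{D}$, $r>\epsilon$, $q<\delta_{f,i}(\epsilon)$; (A14) $(q\mathbin{\dot{-}}dzw)\wedge((P\bar xz\bar y\mathbin{\dot{-}}P\bar xw\bar y)\mathbin{\dot{-}}r)$ analogously for $P\in\mathcal{R}$.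 Sole rule: modus ponens (from $\varphi$ and $\psi\mathbin{\dot{-}}\varphi$ infer $\psi$). $\Gamma\vdash_Q\varphi$ iff $\varphi$ has a finite derivation from axioms and members of $\Gamma$; inconsistent means proving every formula. $\Delta$ is maximal consistent if it is consistent and for all formulae $\varphi,\psi$: (i) if $\Delta\vdash_Q\varphi\mathbin{\dot{-}}2^{-n}$ for all $n<\omega$ then $\varphi\in\Delta$; (ii) $\varphi\mathbin{\dot{-}}\psi\in\Delta$ or $\psi\mathbin{\dot{-}}\varphi\in\Delta$. $\Delta$ is Henkin complete if for every formula $\varphi$, variable $x$, and $p<q$ in $\mathbb{D}$ there is a constant symbol $c$ with $(\sup_x\varphi\mathbin{\dot{-}}q)\wedge(p\mathbin{\dot{-}}\varphi[c/x])\in\Delta$. *)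

(* Defs.v *)
From HB Require Import structures.
From mathcomp Require Import all_boot all_order all_algebra.
From mathcomp Require Import all_classical all_reals.

Set Implicit Arguments.
Unset Strict Implicit.
Unset Printing Implicit Defensive.

Import Order.TTheory GRing.Theory Num.Theory.

Local Open Scope classical_set_scope.
Local Open Scope ring_scope.

(* [rel_mod P i] and [fun_mod f i] are the moduli delta_{s,i} : (0,1] -> (0,1].
   They are only meaningful for [i] smaller than the arity and on arguments in
   (0,1]; their values elsewhere are never used.  Putting relation and function
   symbols in two different types makes them disjoint.
   [metric = None] is a signature without a metric. *)
Record signature (R : realType) := Signature {
  rel_symb : Type;
  fun_symb : Type;
  rel_nonempty : $| rel_symb |;
  rel_arity : rel_symb -> nat;
  fun_arity : fun_symb -> nat;
  rel_mod : rel_symb -> nat -> R -> R;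
  fun_mod : fun_symb -> nat -> R -> R;
  rel_mod01 : forall P i e, (i < rel_arity P)%N ->
    0 < e <= 1 -> 0 < rel_mod P i e <= 1;
  fun_mod01 : forall f i e, (i < fun_arity f)%N ->
    0 < e <= 1 -> 0 < fun_mod f i e <= 1;
  metric : option rel_symb;
  metric_arity : forall d, metric = Some d -> rel_arity d = 2%N }.

Section Syntax.
Context {R : realType} (L : signature R).

(* The variables are the natural numbers. *)
Inductive term : Type :=
| Var of nat
| App (f : fun_symb L) of ('I_(fun_arity f) -> term).

Inductive formula : Type :=
| Atom (P : rel_symb L) of ('I_(rel_arity P) -> term)
| Dot of formula & formula
| Neg of formula
| Half of formula
| Sup of nat & formula.

Definition FAnd (phi psi : formula) := Dot phi (Dot phi psi).

(* The two-entry family (a, b).  The index type is ['I_n] rather than ['I_2]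
   because the arity of the metric symbol is only propositionally equal to 2. *)
Definition pair_args {T : Type} {n : nat} (a b : T) : 'I_n -> T :=
  fun i => if val i == 0%N then a else b.

Definition dist (d : rel_symb L) (x y : nat) : formula :=
  Atom (P := d) (pair_args (Var x) (Var y)).

(* For [fun_arity c = 0] the family of arguments is empty, so [Var 0] does not
   occur in the constant term. *)
Definition cst (c : fun_symb L) : term := App (f := c) (fun=> Var 0%N).

Fixpoint occurs (x : nat) (t : term) : Prop :=
  match t with
  | Var y => x = y
  | App _ ts => exists i, occurs x (ts i)
  end.

Fixpoint free (x : nat) (phi : formula) : Prop :=
  match phi with
  | Atom _ ts => exists i, occurs x (ts i)
  | Dot a b => free x a \/ free x b
  | Neg a | Half a => free x a
  | Sup y a => x <> y /\ free x a
  end.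

Fixpoint subst_term (x : nat) (t u : term) : term :=
  match u with
  | Var y => if y == x then t else Var y
  | App _ us => App (fun i => subst_term x t (us i))
  end.

(* [subst x t phi] is phi[t/x]; bound variables are not renamed. *)
Fixpoint subst (x : nat) (t : term) (phi : formula) : formula :=
  match phi with
  | Atom _ us => Atom (fun i => subst_term x t (us i))
  | Dot a b => Dot (subst x t a) (subst x t b)
  | Neg a => Neg (subst x t a)
  | Half a => Half (subst x t a)
  | Sup y a => if y == x then Sup y a else Sup y (subst x t a)
  end.

(* No variable of t becomes bound in phi[t/x]. *)
Fixpoint correct_subst (x : nat) (t : term) (phi : formula) : Prop :=
  match phi with
  | Atom _ _ => True
  | Dot a b => correct_subst x t a /\ correct_subst x t b
  | Neg a | Half a => correct_subst x t a
  | Sup y a => free x (Sup y a) -> ~ occurs y t /\ correct_subst x t a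
  end.

(* The abbreviation 1 := ~ (phi -. phi) leaves phi unspecified; a closed phi
   is fixed here, namely sup_x P x ... x for some chosen relation symbol P. *)
Definition FOne : formula :=
  let phi := Sup 0%N (Atom (P := unsquash (rel_nonempty L)) (fun=> Var 0%N)) in
  Neg (Dot phi phi).

Definition FPow2 (n : nat) : formula := iter n Half FOne.

End Syntax.

Arguments Var {R L} _.
Arguments FOne {R L}.
Arguments FPow2 {R L} _.

Inductive dexp : Type :=
| DOne
| DDot of dexp & dexp
| DNeg of dexp
| DHalf of dexp.

Section Dyadic.
Context {R : realType}.

Fixpoint dval (e : dexp) : R :=
  match e with
  | DOne => 1
  | DDot a b => Num.max (dval a - dval b) 0
  | DNeg a => 1 - dval a
  | DHalf a => dval a / 2
  end.

Definition dyadic : set R :=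
  [set r | exists k n : nat, (k <= 2 ^ n)%N /\ r = k%:R / 2 ^+ n].

Lemma dexp_exists (r : R) : dyadic r -> exists e, dval e = r.
Proof.
move=> [k [n [+ ->]]]; elim: k => [_|k IHk kn].
  by exists (DNeg DOne); rewrite /= subrr mul0r.
have [e eE] := IHk (ltnW kn).
have h : dval (iter n DHalf DOne) = (2 ^+ n)^-1.
  elim: {IHk kn eE} n => [|n IHn] /=; first by rewrite expr0 invr1.
  by rewrite IHn exprS invfM mulrC.
exists (DNeg (DDot (DNeg e) (iter n DHalf DOne))) => /=.
rewrite h eE max_l.
  by rewrite -[k.+1%:R]natr1 mulrDl mul1r -addrA -opprD opprB addrC subrK.
rewrite -addrA -opprD subr_ge0 -[X in _ + X]mul1r -mulrDl natr1.
by rewrite ler_pdivrMr ?exprn_gt0// mul1r -natrX ler_nat.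
Qed.

(* A closed expression denoting the dyadic rational r, fixed by choice. *)
Definition dyadic_name (r : R) : dexp :=
  if pselect (exists e, dval e = r) is left ex then sval (cid ex) else DOne.

Lemma dval_dyadic_name (r : R) : dyadic r -> dval (dyadic_name r) = r.
Proof.
move=> /dexp_exists ex; rewrite /dyadic_name.
by case: pselect => // ex'; case: cid.
Qed.

Fixpoint dform {L : signature R} (e : dexp) : formula L :=
  match e with
  | DOne => FOne
  | DDot a b => Dot (dform a) (dform b)
  | DNeg a => Neg (dform a)
  | DHalf a => Half (dform a)
  end.

Definition FDyad {L : signature R} (r : R) : formula L :=
  dform (dyadic_name r).

End Dyadic.

Section Semantics.
Context {R : realType} (L : signature R).

(* [[eta a with i |-> c]] is the family a with its entry at i replaced by c, so
   that f (abar, c, bbar) is [f [eta a with i |-> c]]; the entry a i is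
   irrelevant. *)
Record prestructure := Prestructure {
  carrier : Type;
  carrier_nonempty : $| carrier |;
  fun_int : forall f : fun_symb L,
    ('I_(fun_arity f) -> carrier) -> carrier;
  rel_int : forall P : rel_symb L,
    ('I_(rel_arity P) -> carrier) -> R;
  rel_int01 : forall P a, 0 <= @rel_int P a <= 1;
  metric_refl : forall d, metric L = Some d ->
    forall x, @rel_int d (pair_args x x) = 0;
  metric_sym : forall d, metric L = Some d ->
    forall x y, @rel_int d (pair_args x y) = @rel_int d (pair_args y x);
  metric_triangle : forall d, metric L = Some d ->
    forall x y z, @rel_int d (pair_args x z)
      <= @rel_int d (pair_args x y) + @rel_int d (pair_args y z);
  fun_ucont : forall d, metric L = Some d ->
    forall (f : fun_symb L) (i : 'I_(fun_arity f)) (a : 'I_(fun_arity f) -> carrier)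
      (c e : carrier) (eps : R), 0 < eps <= 1 ->
    @rel_int d (pair_args c e) < fun_mod f i eps ->
    @rel_int d (pair_args (@fun_int f [eta a with i |-> c])
                          (@fun_int f [eta a with i |-> e])) <= eps;
  rel_ucont : forall d, metric L = Some d ->
    forall (P : rel_symb L) (i : 'I_(rel_arity P)) (a : 'I_(rel_arity P) -> carrier)
      (c e : carrier) (eps : R), 0 < eps <= 1 ->
    @rel_int d (pair_args c e) < rel_mod P i eps ->
    Num.max (@rel_int P [eta a with i |-> c]
             - @rel_int P [eta a with i |-> e]) 0 <= eps }.

Fixpoint term_value (M : prestructure) (s : nat -> carrier M) (t : term L) :
    carrier M :=
  match t with
  | Var x => s x
  | App f ts => @fun_int M f (fun i => term_value s (ts i))
  end.

Fixpoint value (M : prestructure) (s : nat -> carrier M) (phi : formula L) : R :=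
  match phi with
  | Atom P ts => @rel_int M P (fun i => term_value s (ts i))
  | Dot a b => Num.max (value s a - value s b) 0
  | Neg a => 1 - value s a
  | Half a => value s a / 2
  | Sup x a => sup (range (fun m => value [eta s with x |-> m] a))
  end.

Definition models (M : prestructure) (s : nat -> carrier M)
    (D : set (formula L)) : Prop :=
  forall phi, D phi -> value s phi = 0.

End Semantics.

Section ProofSystem.
Context {R : realType} (L : signature R).

Inductive axiom : formula L -> Prop :=
| A1 phi psi : axiom (Dot (Dot phi psi) phi)
| A2 phi psi chi :
    axiom (Dot (Dot (Dot chi phi) (Dot chi psi)) (Dot psi phi))
| A3 phi psi :
    axiom (Dot (Dot phi (Dot phi psi)) (Dot psi (Dot psi phi)))
| A4 phi psi : axiom (Dot (Dot phi psi) (Dot (Neg psi) (Neg phi)))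
| A5 phi : axiom (Dot (Half phi) (Dot phi (Half phi)))
| A6 phi : axiom (Dot (Dot phi (Half phi)) (Half phi))
| A7 x phi psi :
    axiom (Dot (Dot (Sup x psi) (Sup x phi)) (Sup x (Dot psi phi)))
| A8 x t phi : correct_subst x t phi ->
    axiom (Dot (subst x t phi) (Sup x phi))
| A9 x phi : ~ free x phi -> axiom (Dot (Sup x phi) phi)
| A10 d x : metric L = Some d -> axiom (dist d x x)
| A11 d x y : metric L = Some d -> axiom (Dot (dist d x y) (dist d y x))
| A12 d x y z : metric L = Some d ->
    axiom (Dot (Dot (dist d x z) (dist d x y)) (dist d y z))
| A13 d (f : fun_symb L) (i : 'I_(fun_arity f)) (xs : 'I_(fun_arity f) -> nat)
    (z w : nat) (eps r q : R) :
    metric L = Some d -> 0 < eps <= 1 -> dyadic r -> dyadic q ->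
    eps < r -> q < fun_mod f i eps ->
    axiom (FAnd
      (Dot (FDyad q) (dist d z w))
      (Dot (Atom (P := d) (pair_args
              (App (fun j => Var ([eta xs with i |-> z] j)))
              (App (fun j => Var ([eta xs with i |-> w] j)))))
           (FDyad r)))
| A14 d (P : rel_symb L) (i : 'I_(rel_arity P)) (xs : 'I_(rel_arity P) -> nat)
    (z w : nat) (eps r q : R) :
    metric L = Some d -> 0 < eps <= 1 -> dyadic r -> dyadic q ->
    eps < r -> q < rel_mod P i eps ->
    axiom (FAnd
      (Dot (FDyad q) (dist d z w))
      (Dot (Dot (Atom (fun j => Var ([eta xs with i |-> z] j)))
                (Atom (fun j => Var ([eta xs with i |-> w] j))))
           (FDyad r)))
| Ageneralization x phi : axiom phi -> axiom (Sup x phi).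

Inductive proves (G : set (formula L)) : formula L -> Prop :=
| proves_axiom phi : axiom phi -> proves G phi
| proves_hyp phi : G phi -> proves G phi
| proves_mp phi psi : proves G phi -> proves G (Dot psi phi) -> proves G psi.

Definition consistent (G : set (formula L)) : Prop :=
  ~ (forall phi, proves G phi).

Definition maximal_consistent (D : set (formula L)) : Prop :=
  [/\ consistent D,
      forall phi, (forall n, proves D (Dot phi (FPow2 n))) -> D phi &
      forall phi psi, D (Dot phi psi) \/ D (Dot psi phi)].

Definition henkin_complete (D : set (formula L)) : Prop :=
  forall (phi : formula L) (x : nat) (p q : R),
    dyadic p -> dyadic q -> p < q ->
    exists2 c : fun_symb L, fun_arity c = 0%N &
      D (FAnd (Dot (Sup x phi) (FDyad q))
              (Dot (FDyad p) (subst x (cst c) phi))).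

End ProofSystem.

(* The inclusion of a signature in a larger one, as an injection on symbols.
   The larger signature has a metric exactly when the smaller one has, and it
   is then the same symbol. *)
Record sig_ext {R : realType} (L L' : signature R) := SigExt {
  ext_rel : rel_symb L -> rel_symb L';
  ext_fun : fun_symb L -> fun_symb L';
  ext_rel_inj : injective ext_rel;
  ext_fun_inj : injective ext_fun;
  ext_rel_arity : forall P, rel_arity (ext_rel P) = rel_arity P;
  ext_fun_arity : forall f, fun_arity (ext_fun f) = fun_arity f;
  ext_rel_mod : forall P i e, (i < rel_arity P)%N -> 0 < e <= 1 ->
    rel_mod (ext_rel P) i e = rel_mod P i e;
  ext_fun_mod : forall f i e, (i < fun_arity f)%N -> 0 < e <= 1 ->
    fun_mod (ext_fun f) i e = fun_mod f i e;
  ext_metric : metric L' = omap ext_rel (metric L) }.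

Section Embedding.
Context {R : realType} {L L' : signature R} (h : sig_ext L L').

Fixpoint emb_term (t : term L) : term L' :=
  match t with
  | Var x => Var x
  | App f ts => App (f := ext_fun h f)
      (fun i => emb_term (ts (cast_ord (ext_fun_arity h f) i)))
  end.

Fixpoint emb_formula (phi : formula L) : formula L' :=
  match phi with
  | Atom P ts => Atom (P := ext_rel h P)
      (fun i => emb_term (ts (cast_ord (ext_rel_arity h P) i)))
  | Dot a b => Dot (emb_formula a) (emb_formula b)
  | Neg a => Neg (emb_formula a)
  | Half a => Half (emb_formula a)
  | Sup x a => Sup x (emb_formula a)
  end.

End Embedding.

(* Main.v *)
(** By soundness, the formulas with value 0 in a model [M] of [G], read over the
    signature with one new constant for each element of [M], form a maximal
    consistent and Henkin complete set: values are real numbers, and a supremum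
    is approximated at some named element.  So it suffices to find a model of
    [G].

    Its elements are closed terms over parameters: one parameter for every
    variable and one witness for every [sup_x a] under every assignment.
    Formulas with such parameters are read as [L]-formulas by naming the
    parameters by fresh variables, and those provable from [G] and from the
    axioms saying that the witnesses attain their suprema form a propositional
    theory.  Finitely many witnesses can be eliminated from a proof, an outermost
    one first, so this theory is consistent.  A maximal consistent theory is
    linearly ordered and archimedean, and measuring formulas against multiples of
    [2^-n] gives a [0,1]-valued homomorphism, from which the relations of the
    model are read off; as suprema are attained, it computes all values. *)

Require Import Defs.
From mathcomp Require Import all_boot all_order all_algebra.
From mathcomp Require Import all_classical all_reals.
From mathcomp Require Import lra zify.

Set Implicit Arguments.
Unset Strict Implicit.
Unset Printing Implicit Defensive.

Import Defs Order.TTheory GRing.Theory Num.Theory.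

Local Open Scope classical_set_scope.
Local Open Scope ring_scope.

(** * Propositional theories and their valuations *)

Section PropositionalTheories.
Context {F : Type} (dot : F -> F -> F) (neg half : F -> F) (zero : F).

(** Closure under (A1) to (A6) and modus ponens, over an abstract language: it is applied both to
    provable formulas and to formulas with parameters. *)
Record theory (T : set F) : Prop := Theory {
  theory_weak : forall a b, T (dot (dot a b) a);
  theory_comp : forall a b c,
    T (dot (dot (dot c a) (dot c b)) (dot b a));
  theory_meetC : forall a b, T (dot (dot a (dot a b)) (dot b (dot b a)));
  theory_contra : forall a b, T (dot (dot a b) (dot (neg b) (neg a)));
  theory_half_ge : forall a, T (dot (half a) (dot a (half a)));
  theory_half_le : forall a, T (dot (dot a (half a)) (half a));
  theory_mp : forall a b, T a -> T (dot b a) -> T b }.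

Local Notation bot := (dot zero zero).
Local Notation one := (neg bot).
Local Notation pow2 n := (iter n half one).

(** The truncated sum [min (a + b, 1)]. *)
Definition add a b := neg (dot (neg a) b).
Definition mul n a := iter n (add a) bot.

Section Theory.
Context (T : set F) (HT : theory T).

(* In every valuation the value of [a] is at most that of [b]. *)
Definition tle a b := T (dot a b).
Local Notation "a '<~' b" := (tle a b) (at level 70).
Local Notation "a \- b" := (dot a b).

Lemma theory_wk a b : T a -> T (a \- b).
Proof. by move=> Ta; exact: (theory_mp HT Ta (theory_weak HT _ _)). Qed.

Lemma tle_mp a b : a <~ b -> T b -> T a.
Proof. by move=> ab Tb; exact: (theory_mp HT Tb ab). Qed.

Lemma tle_trans b a c : a <~ b -> b <~ c -> a <~ c.
Proof.
move=> ab bc; apply: (theory_mp HT ab).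
by apply: (theory_mp HT bc); exact: theory_comp.
Qed.

Lemma dot_le a b : a \- b <~ a. Proof. exact: theory_weak. Qed.

Lemma dot_anti c a b : a <~ b -> c \- b <~ c \- a.
Proof. by move=> ab; apply: (theory_mp HT ab); exact: theory_comp. Qed.

(** [a \- (a \- b)] stands for the minimum of [a] and [b]; (A3) exchanges the two, after which
    weakening applies. *)
Lemma meet_ler a b : a \- (a \- b) <~ b.
Proof. by apply: tle_trans (theory_meetC HT _ _) _; exact: dot_le. Qed.

Lemma le_dot_thm a t : T t -> a <~ a \- t.
Proof. by move=> Tt; apply: tle_mp Tt; exact: meet_ler. Qed.

Lemma tlexx a : a <~ a.
Proof.
have Tt := theory_weak HT a a.
by apply: tle_trans (le_dot_thm _ Tt) _; exact: dot_le.
Qed.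

Lemma thm_bot : T bot. Proof. exact: tlexx. Qed.

Lemma dot_exch a b c : (a \- b) \- c <~ (a \- c) \- b.
Proof.
apply: tle_trans (theory_comp HT b (a \- c) a).
by apply: dot_anti; exact: meet_ler.
Qed.

Lemma tle_exch a b c : a \- b <~ c -> a \- c <~ b.
Proof. by move=> abc; apply: tle_mp abc; exact: dot_exch. Qed.

Lemma dot_mono c a b : a <~ b -> a \- c <~ b \- c.
Proof.
move=> ab; apply: tle_mp ab; apply: tle_exch; exact: theory_comp.
Qed.

Lemma dot_le_neg a b : b \- a <~ neg a.
Proof. by apply: tle_trans (theory_contra HT _ _) _; exact: dot_le. Qed.

Lemma le_negK a : a <~ neg (neg a).
Proof.
have := theory_contra HT a bot => h.
apply: tle_trans (le_dot_thm _ thm_bot) _.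
by apply: tle_trans h _; exact: dot_le_neg.
Qed.

Lemma negK_le a : neg (neg a) <~ a.
Proof. by apply: tle_mp (le_negK (neg a)); exact: theory_contra. Qed.

Lemma neg_dot a b : neg b \- neg a <~ a \- b.
Proof.
apply: tle_trans (theory_contra HT _ _) _.
apply: tle_trans (dot_mono _ (negK_le _)) _.
by apply: dot_anti; exact: le_negK.
Qed.

Lemma neg_anti a b : a <~ b -> neg b <~ neg a.
Proof. by move=> ab; apply: tle_mp ab; exact: neg_dot. Qed.

Lemma le_one a : a <~ one.
Proof.
by apply: tle_mp (dot_le_neg _ _) _; apply: tle_mp (negK_le _) _; exact: thm_bot.
Qed.

Lemma bot_le a : bot <~ a. Proof. by apply: theory_wk; exact: thm_bot. Qed.

Lemma thm_le a b : T a -> a <~ b. Proof. exact: theory_wk. Qed.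

Lemma le_bot a : a <~ bot -> T a.
Proof. by move/tle_mp; apply; exact: thm_bot. Qed.

Lemma dot_negr a b : a \- neg b <~ b \- neg a.
Proof.
apply: tle_trans (theory_contra HT _ _) _.
by apply: dot_mono; exact: negK_le.
Qed.

(** With its converse [add_dot] this gives the adjunction [a \- b <~ c] iff [a <~ add c b], from
    which commutativity and associativity of [add] follow. *)
Lemma dot_add a b c : a \- add c b <~ (a \- b) \- c.
Proof.
apply: tle_trans (dot_negr _ _) _; apply: tle_trans (dot_exch _ _ _) _.
apply: tle_trans (dot_mono _ (neg_dot _ _)) _; exact: dot_exch.
Qed.

Lemma add_dot a b c : (a \- b) \- c <~ a \- add c b.
Proof.
apply: tle_trans (dot_negr _ _).
apply: tle_trans (dot_exch _ _ _).
apply: tle_trans (dot_exch _ _ _) _; apply: dot_mono; exact: theory_contra.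
Qed.

Lemma le_addP a b c : a \- b <~ c -> a <~ add c b.
Proof. by move=> abc; apply: tle_mp abc; exact: dot_add. Qed.

Lemma dot_leP a b c : a <~ add c b -> a \- b <~ c.
Proof. by move=> abc; apply: tle_mp abc; exact: add_dot. Qed.

Lemma le_dotK a b : a <~ add (a \- b) b.
Proof. by apply/le_addP; exact: tlexx. Qed.

Lemma addC_le a b : add a b <~ add b a.
Proof. by apply/le_addP/tle_exch/dot_leP; exact: tlexx. Qed.

Lemma add_monol c a b : a <~ b -> add a c <~ add b c.
Proof. by move=> ab; apply/neg_anti/dot_mono/neg_anti. Qed.

Lemma add_mono a b c d : a <~ b -> c <~ d -> add a c <~ add b d.
Proof.
move=> ab cd; apply: tle_trans (add_monol _ ab) _.
by apply/neg_anti/dot_anti.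
Qed.

Lemma le_addl a b : a <~ add a b.
Proof. by apply/le_addP; exact: dot_le. Qed.

Lemma le_addr a b : b <~ add a b.
Proof. by apply: tle_trans (addC_le _ _); exact: le_addl. Qed.

Lemma addA_le a b c : add a (add b c) <~ add (add a b) c.
Proof.
apply/le_addP/le_addP; apply: tle_trans (add_dot _ _ _) _.
by apply/dot_leP; exact: tlexx.
Qed.

Lemma addA_ge a b c : add (add a b) c <~ add a (add b c).
Proof.
apply/le_addP; apply: tle_trans (dot_add _ _ _) _.
by apply/dot_leP/dot_leP; exact: tlexx.
Qed.

Lemma add0_le a : add bot a <~ a.
Proof.
apply: tle_trans (negK_le _); apply: neg_anti.
apply: tle_trans (le_dot_thm _ thm_bot) _.
by apply: tle_trans (theory_contra HT _ _) _; apply: dot_anti; exact: le_negK.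
Qed.

Lemma le_meet a b c : c <~ a -> c <~ b -> c <~ a \- (a \- b).
Proof.
move=> ca cb; apply: tle_trans (dot_anti _ (dot_anti _ cb)).
apply: tle_trans (theory_meetC HT _ _).
exact: le_dot_thm.
Qed.

(** After negation, [neg a] has to lie below [neg b \- (a \- b)]; it lies below the meet
    [neg b \- (neg b \- neg a)], and (A4) compares the two. *)
Lemma dotK_le a b : b <~ a -> add b (a \- b) <~ a.
Proof.
move=> ba; apply: tle_trans (negK_le a); apply: neg_anti.
apply: tle_trans (le_meet (neg_anti ba) (tlexx _)) _.
by apply: dot_anti; exact: theory_contra.
Qed.

(** The differences [d] and [e] are disjoint: [a] is at most [(a \- d) + d], hence at most
    [(b \- e) + e + (d \- e)], which is at most [b + (d \- e)]. So [d <~ d \- e], and the meet of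
    [d] and [e] is a theorem. *)
Lemma prelinearity u a b : u <~ a \- b -> u <~ b \- a -> T u.
Proof.
set d := a \- b; set e := b \- a => ud ue.
have de : d <~ d \- e.
  rewrite {1}/d; apply: dot_leP.
  have h1 : a <~ add (a \- d) d := le_dotK _ _.
  have h2 : a \- d <~ b \- e := theory_meetC HT _ _.
  apply: tle_trans h1 _; apply: tle_trans (add_mono h2 (le_dotK d e)) _.
  apply: tle_trans (addC_le _ _) _; apply: tle_trans (addA_ge _ _ _) _.
  apply: add_mono (tlexx _) _.
  by apply: dotK_le; exact: dot_le.
have u_meet : u <~ d \- (d \- e) by exact: le_meet.
exact: tle_mp u_meet de.
Qed.

Lemma half_le a : half a <~ a.
Proof. by apply: tle_trans (theory_half_ge HT _) _; exact: dot_le. Qed.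

Lemma le_add_half a : a <~ add (half a) (half a).
Proof. by apply/le_addP; exact: theory_half_le. Qed.

Lemma add_half_le a : add (half a) (half a) <~ a.
Proof.
apply: tle_trans (dotK_le (half_le a)).
by apply: add_mono; [exact: tlexx | exact: theory_half_ge].
Qed.

Lemma half_half_neg a : half a <~ neg (half a).
Proof. by apply: tle_trans (theory_half_ge HT _) _; exact: dot_le_neg. Qed.

(** By prelinearity it is enough that [half b \- a] lies below the opposite difference
    [a \- half b]; this follows from [half b <~ b \- half b] and [b <~ add a a]. *)
Lemma half_le_of_double a b : b <~ add a a -> half b <~ a.
Proof.
move=> baa; apply: (@prelinearity _ (half b) a); first exact: tlexx.
apply: tle_trans (_ : (add a a \- half b) \- a <~ _).
  apply: dot_mono; apply: tle_trans (theory_half_ge HT _) _; exact: dot_mono.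
apply: tle_trans (dot_exch _ _ _) _; apply: dot_mono.
by apply/dot_leP; exact: tlexx.
Qed.

Definition double k a := iter k (fun b => add b b) a.

Lemma pow2_le_of_double k a b : b <~ double k a -> iter k half b <~ a.
Proof.
elim: k b => [//|k IHk] b; rewrite iterSr => bk.
by apply: IHk; apply: half_le_of_double.
Qed.

Lemma half_thm a : T (half a) -> T a.
Proof.
by move=> h; apply: (theory_mp HT h); exact: tle_mp (theory_half_le HT _) h.
Qed.

Lemma pow2_thm n : T (pow2 n) -> T one.
Proof. by elim: n => [//|n IHn] /half_thm /IHn. Qed.

Lemma pow2_anti m n : (m <= n)%N -> pow2 n <~ pow2 m.
Proof.
move/subnK <-; elim: (n - m)%N => [|k IHk]; first exact: tlexx.
by apply: tle_trans IHk; exact: half_le.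
Qed.

Definition dots n a t := iter n (dot^~ t) a.

Lemma dots_mono n t a b : a <~ b -> dots n a t <~ dots n b t.
Proof. by elim: n => [//|n IHn] ab /=; apply/dot_mono/IHn. Qed.

Lemma dots_exch n t a b : dots n a t \- b <~ dots n (a \- b) t.
Proof.
elim: n => [|n IHn] /=; first exact: tlexx.
by apply: tle_trans (dot_exch _ _ _) _; exact: dot_mono.
Qed.

(** The theory generated by [T] and [t], in the form given by the deduction theorem: a hypothesis
    may be used several times, so it is subtracted several times. *)
Definition extend t : set F := [set a | exists n, T (dots n a t)].

Lemma sub_extend t : T `<=` extend t.
Proof. by move=> a Ta; exists 0%N. Qed.

Lemma extend_mem t : extend t t.
Proof. by exists 1%N; exact: tlexx. Qed.

Lemma extend_mp t a b : extend t a -> extend t (b \- a) -> extend t b.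
Proof.
move=> [n na] [m mba]; exists (n + m)%N; rewrite /dots iterD.
apply: tle_mp na; apply: dots_mono.
exact: tle_mp (dots_exch _ _ _ _) mba.
Qed.

Lemma extend_theory t : theory (extend t).
Proof.
split=> [a b|a b c|a b|a b|a|a|a b]; try exact: extend_mp;
  apply: sub_extend.
- exact: theory_weak.
- exact: theory_comp.
- exact: theory_meetC.
- exact: theory_contra.
- exact: theory_half_ge.
- exact: theory_half_le.
Qed.

Lemma dots_double k a t : a \- double k t <~ dots (2 ^ k) a t.
Proof.
elim: k a => [|k IHk] a /=; first exact: tlexx.
rewrite expnS mul2n -addnn /dots iterD; apply: tle_trans (dot_add _ _ _) _.
exact: tle_trans (dot_mono _ (IHk _)) (IHk _).
Qed.

(** If [n] copies of [t] exhaust [one], so do [2 ^ n] copies, and halving [n] times leaves [2^-n]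
    below [t]. *)
Lemma extend_one t : extend t one -> exists k, pow2 k <~ t.
Proof.
move=> [n nt]; exists n; apply: pow2_le_of_double.
apply: tle_mp (dots_double _ _ _) _.
rewrite -(subnK (ltnW (ltn_expl n (ltnSn 1)))) /dots iterD.
by elim: (2 ^ n - n)%N => [//|m IHm] /=; apply: theory_wk.
Qed.

(** If equating [f] with the larger [s] is contradictory, then a definite gap [2^-k] separates them.
    Used with a supremum for [s] and an instance of it for [f]. *)
Lemma extend_dot_one s f : f <~ s -> extend (s \- f) one ->
  exists2 k, pow2 k <~ s & f <~ s \- pow2 k.
Proof.
move=> fs /extend_one[k ksf]; exists k; first exact: tle_trans ksf (dot_le _ _).
by apply: tle_trans (dot_anti _ ksf); apply: le_meet fs (tlexx _).
Qed.

Lemma le_dot_self s e : e <~ s -> s <~ s \- e -> T e.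
Proof. by move=> es; apply: tle_mp; apply: le_meet es (tlexx _). Qed.
End Theory.

(** By Zorn's lemma; adjoining a formula outside the maximal theory yields [one], which [extend_one]
    turns into a lower bound [2^-k]. *)
Lemma maximal_extension (T : set F) : theory T -> ~ T one ->
  exists U : set F, [/\ theory U, T `<=` U, ~ U one &
    forall t, U t \/ exists k, tle U (pow2 k) t].
Proof.
move=> HT Tone.
pose P (A : set F) := A = set0 \/ [/\ theory A, T `<=` A & ~ A one].
have [A [PA maxA]] : exists A, P A /\ forall B, A `<` B -> ~ P B.
  apply: Zorn_bigcup => C CP Ctot.
  have [[A0 [CA0 A0n]]|noA] := pselect (exists A, C A /\ A <> set0); last first.
    left; apply/seteqP; split=> // a [A CA Aa]; apply: noA; exists A; split=> //.
    by move=> A0; rewrite A0 in Aa.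
  have CT A a : C A -> A a -> [/\ theory A, T `<=` A & ~ A one].
    by move=> CA Aa; case: (CP _ CA) => // A0'; rewrite A0' in Aa.
  have [a0 A0a0] : exists a, A0 a.
    by apply: contra_notP A0n => no; apply/seteqP; split=> // a Aa; apply: no; exists a.
  have [HA0 TA0 A0one] := CT _ _ CA0 A0a0.
  right; split; last first.
  - by move=> [A CA Aone]; have [_ _ /(_ Aone)] := CT _ _ CA Aone.
  - by move=> a /TA0; exists A0.
  split=> [a b|a b c|a b|a b|a|a|a b].
  - by exists A0 => //; exact: theory_weak.
  - by exists A0 => //; exact: theory_comp.
  - by exists A0 => //; exact: theory_meetC.
  - by exists A0 => //; exact: theory_contra.
  - by exists A0 => //; exact: theory_half_ge.
  - by exists A0 => //; exact: theory_half_le.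
  - move=> [A CA Aa] [B CB Bba].
    have [HA _ _] := CT _ _ CA Aa; have [HB _ _] := CT _ _ CB Bba.
    have [AB|BA] := Ctot _ _ CA CB.
      by exists B => //; exact: (theory_mp HB (AB _ Aa) Bba).
    by exists A => //; exact: (theory_mp HA Aa (BA _ Bba)).
have [HA TA Aone] : [/\ theory A, T `<=` A & ~ A one].
  case: PA => // A0; exfalso; apply: (maxA T); last by right; split.
  by rewrite A0; split=> // /(_ _ (thm_bot HT)).
exists A; split=> // t; have [At|nAt] := pselect (A t); [by left|right].
have [Eone|nEone] := pselect (extend A t one).
  by have [k ?] := extend_one HA Eone; exists k.
exfalso; apply: (maxA (extend A t)).
  split; first exact: sub_extend.
  by move=> EA; apply: nAt; apply: EA; exact: extend_mem.
right; split=> //; first exact: extend_theory.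
by move=> a /TA; exact: sub_extend.
Qed.

(** * The real valuation of an archimedean theory *)

Section Valuation.
Context {R : realType} (T : set F) (HT : theory T) (Tone : ~ T one).
Context (T_arch : forall t, T t \/ exists k, tle T (pow2 k) t).
Local Notation "a '<~' b" := (tle T a b) (at level 70).
Local Notation "a \- b" := (dot a b).

(** Otherwise both differences lie above some common [2^-n], which prelinearity makes a theorem. *)
Lemma tle_total a b : a <~ b \/ b <~ a.
Proof.
have [|[k ka]] := T_arch (a \- b); first by left.
have [|[l lb]] := T_arch (b \- a); first by right.
exfalso; apply: Tone; apply: (pow2_thm HT (n := k + l)).
apply: (prelinearity HT) (tle_trans HT _ ka) (tle_trans HT _ lb).
  by apply: pow2_anti => //; exact: leq_addr.
by apply: pow2_anti => //; exact: leq_addl.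
Qed.

Lemma mulD_le i j e : mul (i + j) e <~ add (mul i e) (mul j e).
Proof.
elim: i => [|i IHi]; first exact: le_addr.
apply: (tle_trans HT) (addA_le HT _ _ _).
by apply: (add_mono HT) => //; exact: tlexx.
Qed.

Lemma mulD_ge i j e : add (mul i e) (mul j e) <~ mul (i + j) e.
Proof.
elim: i => [|i IHi]; first exact: add0_le.
apply: (tle_trans HT) (addA_ge HT _ _ _) _.
by apply: (add_mono HT) => //; exact: tlexx.
Qed.

Lemma mul_leq i j e : (i <= j)%N -> mul i e <~ mul j e.
Proof.
move/subnK <-; elim: (j - i)%N => [|k IHk]; first exact: tlexx.
by apply: (tle_trans HT) IHk _; exact: le_addr.
Qed.

Lemma mul_double_le k n : mul k (pow2 n) <~ mul k.*2 (pow2 n.+1).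
Proof.
elim: k => [|k IHk]; first exact: tlexx.
rewrite doubleS; apply: (tle_trans HT) (addA_ge HT _ _ _).
by apply: (add_mono HT) => //; exact: le_add_half.
Qed.

Lemma mul_double_ge k n : mul k.*2 (pow2 n.+1) <~ mul k (pow2 n).
Proof.
elim: k => [|k IHk]; first exact: tlexx.
rewrite doubleS; apply: (tle_trans HT) (addA_le HT _ _ _) _.
by apply: (add_mono HT) => //; exact: add_half_le.
Qed.

Lemma mul_refine_le k n j : mul k (pow2 n) <~ mul (k * 2 ^ j) (pow2 (j + n)).
Proof.
elim: j => [|j IHj]; first by rewrite muln1; exact: tlexx.
rewrite expnS mulnCA mul2n; apply: (tle_trans HT) IHj _; exact: mul_double_le.
Qed.

Lemma mul_refine_ge k n j : mul (k * 2 ^ j) (pow2 (j + n)) <~ mul k (pow2 n).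
Proof.
elim: j => [|j IHj]; first by rewrite muln1; exact: tlexx.
rewrite expnS mulnCA mul2n; apply: (tle_trans HT) IHj; exact: mul_double_ge.
Qed.

Lemma one_le_mul n : one <~ mul (2 ^ n) (pow2 n).
Proof.
have := mul_refine_le 1 0 n; rewrite mul1n addn0; apply: (tle_trans HT).
exact: le_addl.
Qed.

(** This controls the truncation: one step short of [2 ^ n], room for another [2^-n] is left. The
    induction uses [2 ^ n.+1 - 1 = 2 * (2 ^ n - 1) + 1]. *)
Lemma mul_pred_le_neg n : mul (2 ^ n).-1 (pow2 n) <~ neg (pow2 n).
Proof.
elim: n => [|n IHn]; first exact: bot_le.
have -> : (2 ^ n.+1).-1 = ((2 ^ n).-1.*2).+1.
  by rewrite expnS mul2n -{1}(@prednK (2 ^ n)) ?expn_gt0.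
have le1 := tle_trans HT (mul_double_ge (2 ^ n).-1 n) IHn.
have le2 : neg (pow2 n) <~ neg (pow2 n.+1) \- pow2 n.+1.
  apply: (tle_trans HT) (neg_anti HT (add_half_le HT _)) _; exact: negK_le.
apply: (tle_trans HT) (dotK_le HT (half_half_neg HT (pow2 n))).
apply: (add_mono HT) (tlexx HT _) _; exact: (tle_trans HT) le1 le2.
Qed.

(** If two consecutive multiples collapse, all later ones do; then [one] is below the multiple by
    [2 ^ n - 1], hence below [neg (pow2 n)], and [pow2 n] is a theorem. *)
Lemma mul_lt l n : (l < 2 ^ n)%N -> ~ mul l.+1 (pow2 n) <~ mul l (pow2 n).
Proof.
move=> ln le; apply: Tone; apply: (pow2_thm HT (n := n)).
have all j : mul (j + l) (pow2 n) <~ mul l (pow2 n).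
  elim: j => [|j IHj]; first exact: tlexx.
  by apply: (tle_trans HT) le; apply: (add_mono HT) (tlexx HT _) IHj.
have one_neg : one <~ neg (pow2 n).
  apply: (tle_trans HT) (mul_pred_le_neg n).
  apply: (tle_trans HT) (one_le_mul n) _; rewrite -{1}(subnK (ltnW ln)).
  apply: (tle_trans HT) (all _) _; apply: mul_leq.
  by rewrite -ltnS prednK ?expn_gt0.
apply: (le_bot HT).
exact: (tle_mp HT (theory_contra HT _ _) one_neg).
Qed.

Lemma mul_inj_leq k l n : (k <= 2 ^ n)%N ->
  mul k (pow2 n) <~ mul l (pow2 n) -> (k <= l)%N.
Proof.
move=> kn kl; rewrite leqNgt; apply/negP => lk.
apply: (mul_lt (leq_trans lk kn)).
by apply: (tle_trans HT) kl; exact: mul_leq.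
Qed.

Lemma dyadic_ler k l m n : (k * 2 ^ m <= l * 2 ^ n)%N ->
  k%:R / 2 ^+ n <= l%:R / 2 ^+ m :> R.
Proof.
move=> h; rewrite ler_pdivrMr ?exprn_gt0// mulrAC ler_pdivlMr ?exprn_gt0//.
by rewrite -!natrX -!natrM ler_nat.
Qed.

Lemma mul_ler k l m n : (k <= 2 ^ n)%N -> mul k (pow2 n) <~ mul l (pow2 m) ->
  k%:R / 2 ^+ n <= l%:R / 2 ^+ m :> R.
Proof.
move=> kn kl; apply: dyadic_ler; apply: (@mul_inj_leq _ _ (m + n)).
  by rewrite expnD mulnC leq_mul2l kn orbT.
apply: (tle_trans HT) (mul_refine_ge _ _ _) _.
by apply: (tle_trans HT) kl _; rewrite addnC; exact: mul_refine_le.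
Qed.

(** The lower Dedekind cut of [a] among the dyadic rationals. Truncated multiples saturate at [one],
    so [k] has to be bounded by [2 ^ n]. *)
Definition cuts a : set R := [set r | exists n k,
  [/\ (k <= 2 ^ n)%N, mul k (pow2 n) <~ a & r = k%:R / 2 ^+ n]].

Definition valuation a : R := sup (cuts a).

Lemma cuts_ub a : has_ubound (cuts a).
Proof.
exists 1 => _ [n [k [kn _ ->]]].
by rewrite ler_pdivrMr ?exprn_gt0// mul1r -natrX ler_nat.
Qed.

Lemma valuation_ge k n a : (k <= 2 ^ n)%N -> mul k (pow2 n) <~ a ->
  k%:R / 2 ^+ n <= valuation a.
Proof. by move=> kn ka; apply: (ub_le_sup (cuts_ub a)); exists n, k. Qed.

Lemma cuts0 a : cuts a 0.
Proof. by exists 0%N, 0%N; split; rewrite ?mul0r//; exact: bot_le. Qed.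

Lemma valuation_le m n a : a <~ mul m (pow2 n) -> valuation a <= m%:R / 2 ^+ n.
Proof.
move=> am; apply: ge_sup; first by exists 0; exact: cuts0.
move=> _ [p [k [kp ka ->]]]; apply: mul_ler => //; exact: (tle_trans HT) ka am.
Qed.

Lemma valuation_mono a b : a <~ b -> valuation a <= valuation b.
Proof.
move=> ab; apply: ge_sup; first by exists 0; exact: cuts0.
move=> _ [p [k [kp ka ->]]]; apply: valuation_ge => //.
exact: (tle_trans HT) ka ab.
Qed.

Lemma valuation_thm a : T a -> valuation a = 0.
Proof.
move=> Ta; apply/eqP; rewrite eq_le; apply/andP; split.
  have := @valuation_le 0 0 a (thm_le HT _ Ta); by rewrite mul0r.
by apply: (ub_le_sup (cuts_ub a)); exact: cuts0.
Qed.

Lemma valuation01 a : 0 <= valuation a <= 1.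
Proof.
apply/andP; split; first by apply: (ub_le_sup (cuts_ub a)); exact: cuts0.
have := @valuation_le 1 0 a; rewrite expr0 divr1; apply.
by apply: (tle_trans HT) (le_one HT _) _; exact: le_addl.
Qed.

(** The multiples of [2^-n] are tried in increasing order, each comparable with [a]; if even the
    multiple by [2 ^ n] is below [a], then [a <~ one] gives the upper bound. *)
Lemma bracket n a : exists k,
  [/\ (k <= 2 ^ n)%N, mul k (pow2 n) <~ a & a <~ mul k.+1 (pow2 n)].
Proof.
have step m : (m <= 2 ^ n)%N -> (exists k,
  [/\ (k <= 2 ^ n)%N, mul k (pow2 n) <~ a & a <~ mul k.+1 (pow2 n)]) \/
    mul m (pow2 n) <~ a.
  elim: m => [_|m IHm mn]; first by right; exact: bot_le.
  have [|ma] := IHm (ltnW mn); first by left.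
  have [|am] := tle_total (mul m.+1 (pow2 n)) a; first by right.
  by left; exists m; split=> //; exact: ltnW.
have [//|ge] := step _ (leqnn _); exists (2 ^ n)%N; split=> //.
apply: (tle_trans HT) (le_one HT _) _.
by apply: (tle_trans HT) (one_le_mul n) _; exact: mul_leq.
Qed.

Lemma ler_pow2 (x y : R) : (forall n, x <= y + 2 / 2 ^+ n) -> x <= y.
Proof.
move=> h; rewrite leNgt; apply/negP => yx.
have xy : 0 < x - y by rewrite subr_gt0.
have := archi_boundP (ltW (divr_gt0 (ltr0n R 2) xy)).
set N := Num.Def.archi_bound _ => hN; have := h N.
rewrite addrC -lerBlDr ler_pdivlMr ?exprn_gt0// leNgt => /negP; apply.
rewrite mulrC -ltr_pdivrMr//; apply: lt_trans hN _.
by rewrite -natrX ltr_nat ltn_expl.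
Qed.

Lemma valuation_add a b : a <~ neg b ->
  valuation (add a b) = valuation a + valuation b.
Proof.
move=> ab; apply/eqP; rewrite eq_le; apply/andP; split; apply: ler_pow2 => n;
  have [k [kn ka ak]] := bracket n a; have [l [ln lb bl]] := bracket n b.
  have := @valuation_le (k.+1 + l.+1) n (add a b).
  move=> /(_ (tle_trans HT (add_mono HT ak bl) (mulD_ge _ _ _))).
  move=> /le_trans; apply.
  rewrite natrD -(natr1 k) -(natr1 l) !mulrDl; have := valuation_ge kn ka.
  have := valuation_ge ln lb; lra.
(* Here [a <~ neg b] excludes truncation: [k] copies of [2^-n] lie below [neg b], hence below
   [2 ^ n - l] copies. *)
have kln : (k + l <= 2 ^ n)%N.
  rewrite addnC -(subnKC ln) leq_add2l; apply: (mul_inj_leq kn).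
  apply: (tle_trans HT) ka _; apply: (tle_trans HT) ab _.
  apply: (tle_trans HT) (neg_anti HT lb) _.
  apply: (tle_trans HT) (le_dot_thm HT _ (thm_bot HT)) _.
  apply: (tle_trans HT) (theory_contra HT _ _) _.
  apply: (tle_trans HT) (dot_anti HT _ (le_negK HT _)) _.
  apply: (dot_leP HT); apply: (tle_trans HT) (mulD_le _ _ _).
  apply: (tle_trans HT) (one_le_mul n) _; rewrite subnK//; exact: tlexx.
have := valuation_ge kln (tle_trans HT (mulD_le _ _ _) (add_mono HT ka lb)).
have := valuation_le ak; have := valuation_le bl.
rewrite natrD -(natr1 k) -(natr1 l) !mulrDl; lra.
Qed.

(** When [b <~ a], [a] is equivalent to the sum of [a \- b] and [b], and [a \- b <~ neg b] makes the
    valuation additive on it. *)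
Lemma valuation_dot a b :
  valuation (a \- b) = Num.max (valuation a - valuation b) 0.
Proof.
have [ab|ba] := tle_total a b.
  rewrite max_r ?subr_le0; first exact: valuation_thm.
  exact: valuation_mono.
have val_a : valuation a = valuation (a \- b) + valuation b.
  rewrite -valuation_add; last exact: dot_le_neg.
  apply/eqP; rewrite eq_le !valuation_mono//; last exact: le_dotK.
  by apply: (tle_trans HT) (addC_le HT _ _) _; exact: dotK_le.
by rewrite val_a addrK max_l//; case/andP: (valuation01 (a \- b)).
Qed.

Lemma valuation_one : valuation one = 1.
Proof.
apply/eqP; rewrite eq_le; case/andP: (valuation01 one) => _ -> /=.
have := @valuation_ge 1 0 one isT; rewrite expr0 divr1; apply.
by apply: (tle_trans HT) (addC_le HT _ _) _; exact: add0_le.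
Qed.

Lemma valuation_neg a : valuation (neg a) = 1 - valuation a.
Proof.
have -> : valuation (neg a) = valuation (one \- a).
  apply/eqP; rewrite eq_le !valuation_mono//.
    apply: (tle_trans HT) (dot_anti HT _ (negK_le HT _)) _.
    apply: (tle_trans HT) (neg_dot HT _ _) _.
    exact: dot_le.
  apply: (tle_trans HT) (le_dot_thm HT _ (thm_bot HT)) _.
  apply: (tle_trans HT) (theory_contra HT _ _) _.
  by apply: dot_anti => //; exact: le_negK.
rewrite valuation_dot valuation_one max_l// subr_ge0.
by case/andP: (valuation01 a).
Qed.

Lemma valuation_half a : valuation (half a) = valuation a / 2.
Proof.
have : valuation a = valuation (half a) + valuation (half a).
  rewrite -valuation_add; last exact: half_half_neg.
  by apply/eqP; rewrite eq_le !valuation_mono//;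
    [exact: add_half_le | exact: le_add_half].
lra.
Qed.

End Valuation.

Lemma exists_valuation (R : realType) (T : set F) : theory T -> ~ T one ->
  exists v : F -> R,
    [/\ forall a, 0 <= v a <= 1,
        forall a b, v (dot a b) = Num.max (v a - v b) 0,
        forall a, v (neg a) = 1 - v a,
        forall a, v (half a) = v a / 2 &
        forall a, T a -> v a = 0].
Proof.
move=> HT /(maximal_extension HT)[U [HU TU Uone arch]].
exists (valuation U); split=> [a|a b|a|a|a Ta].
- exact: valuation01.
- exact: valuation_dot.
- exact: valuation_neg.
- exact: valuation_half.
- by apply: valuation_thm => //; exact: TU.
Qed.

End PropositionalTheories.

(** * Substitutions and derivations *)

Section Substitution.
Context {R : realType} {L : signature R}.
Implicit Types (t u : term L) (phi a : formula L) (s : nat -> term L).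

Fixpoint psubst_term s t : term L :=
  match t with
  | Var x => s x
  | App f ts => App (fun i => psubst_term s (ts i))
  end.

(* Bound variables are not renamed, so variables of [s n] may be captured. *)
Fixpoint psubst s phi : formula L :=
  match phi with
  | Atom P ts => Atom (fun i => psubst_term s (ts i))
  | Dot a b => Dot (psubst s a) (psubst s b)
  | Neg a => Neg (psubst s a)
  | Half a => Half (psubst s a)
  | Sup x a => Sup x (psubst [eta s with x |-> Var x] a)
  end.

(* All bound variables are strictly smaller than [bound phi]. *)
Fixpoint bound phi : nat :=
  match phi with
  | Atom _ _ => 0
  | Dot a b => maxn (bound a) (bound b)
  | Neg a | Half a => bound a
  | Sup x a => maxn x.+1 (bound a)
  end.

Lemma psubst_term_ext s s' t : (forall n, occurs n t -> s n = s' n) ->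
  psubst_term s t = psubst_term s' t.
Proof.
elim: t => [x|f ts IH] /= ss'; first exact: ss'.
by congr App; apply/funext => i; apply: IH => n ni; apply: ss'; exists i.
Qed.

Lemma psubst_ext s s' phi : (forall n, free n phi -> s n = s' n) ->
  psubst s phi = psubst s' phi.
Proof.
elim: phi s s' => [P ts|a IHa b IHb|a IHa|a IHa|x a IHa] s s' /= ss'.
- congr Atom; apply/funext => i; apply: psubst_term_ext => n ni.
  by apply: ss'; exists i.
- by rewrite (IHa s s') ?(IHb s s')// => n na; apply: ss'; [right|left].
- by rewrite (IHa s s').
- by rewrite (IHa s s').
- congr Sup; apply: IHa => n na /=; case: eqVneq => // /eqP nx.
  exact: ss'.
Qed.

Lemma psubst_term_Var t : psubst_term (@Var R L) t = t.
Proof. by elim: t => [//|f ts IH] /=; congr App; apply/funext. Qed.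

Lemma psubst_Var phi : psubst (@Var R L) phi = phi.
Proof.
elim: phi => [P ts|a IHa b IHb|a IHa|a IHa|x a IHa] /=; rewrite ?IHa ?IHb//.
  by congr Atom; apply/funext => i; exact: psubst_term_Var.
congr Sup; rewrite -[RHS]IHa; apply: psubst_ext => n _ /=.
by case: eqP => // ->.
Qed.

Lemma psubst_id s phi : (forall n, free n phi -> s n = Var n) ->
  psubst s phi = phi.
Proof. by move=> h; rewrite (psubst_ext h) psubst_Var. Qed.

Lemma occurs_psubst_term x s t : occurs x (psubst_term s t) ->
  exists2 n, occurs n t & occurs x (s n).
Proof.
elim: t => [y|f ts IH] /=; first by exists y.
by move=> [i /IH[n ni xn]]; exists n => //; exists i.
Qed.

Lemma free_psubst x s phi : free x (psubst s phi) ->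
  exists2 n, free n phi & occurs x (s n).
Proof.
elim: phi s => [P ts|a IHa b IHb|a IHa|a IHa|y a IHa] s /=.
- by move=> [i /occurs_psubst_term[n ni xn]]; exists n => //; exists i.
- by move=> [/IHa|/IHb] [n na xn]; exists n => //; [left|right].
- exact: IHa.
- exact: IHa.
- move=> [xy /IHa[n na]] /=; case: eqVneq => [_ //|/eqP ny xn].
  by exists n.
Qed.

Lemma bound_psubst s phi : bound (psubst s phi) = bound phi.
Proof.
by elim: phi s => [P ts|a IHa b IHb|a IHa|a IHa|y a IHa] s //=; rewrite ?IHa ?IHb.
Qed.

Lemma subst_term_id x t u : ~ occurs x u -> subst_term x t u = u.
Proof.
elim: u => [y|f ts IH] /= xu; first by case: eqP => // yx; case: xu.
by congr App; apply/funext => i; apply: IH => xi; apply: xu; exists i.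
Qed.

Lemma subst_psubst_term x t s s' u :
  (forall n, occurs n u -> s' n = subst_term x t (s n)) ->
  subst_term x t (psubst_term s u) = psubst_term s' u.
Proof.
elim: u => [y|f ts IH] /= ss'; first by rewrite ss'.
by congr App; apply/funext => i; apply: IH => n ni; apply: ss'; exists i.
Qed.

(** The side condition concerns quantifiers on [x], under which [subst] does nothing: either there
    are none, or no other variable is sent to a term containing [x]. *)
Lemma subst_psubst x t s s' phi :
  (forall n, free n phi -> s' n = subst_term x t (s n)) ->
  (bound phi <= x)%N \/ (forall n, n <> x -> ~ occurs x (s n)) ->
  subst x t (psubst s phi) = psubst s' phi.
Proof.
elim: phi s s' => [P ts|a IHa b IHb|a IHa|a IHa|y a IHa] s s' /= ss' xb.
- congr Atom; apply/funext => i; apply: subst_psubst_term => n ni.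
  by apply: ss'; exists i.
- have [xa xb'] : ((bound a <= x)%N \/ (forall n, n <> x -> ~ occurs x (s n))) /\
      ((bound b <= x)%N \/ (forall n, n <> x -> ~ occurs x (s n))).
    case: xb => [|h]; last by split; right.
    by rewrite geq_max => /andP[]; split; left.
  by rewrite (IHa s s') ?(IHb s s')// => n h; apply: ss'; [right|left].
- by rewrite (IHa s s').
- by rewrite (IHa s s').
- case: eqVneq => [yx|/eqP yx].
    congr Sup; apply: psubst_ext => n na /=; case: eqVneq => // /eqP ny.
    rewrite ss' ?subst_term_id//; case: xb => [|h].
      by rewrite geq_max -yx ltnn.
    by apply: h; rewrite -yx.
  congr Sup; apply: IHa => [n na /=|].
    by case: eqVneq => [_|/eqP ny] /=; [case: eqP | exact: ss'].
  case: xb => [|h]; first by rewrite geq_max => /andP[_]; left.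
  by right=> n nx /=; case: eqP => [_ /= /esym//|_]; exact: h.
Qed.

Lemma correct_subst_bound x t phi :
  (forall y, (y < bound phi)%N -> ~ occurs y t) -> correct_subst x t phi.
Proof.
elim: phi => [P ts|a IHa b IHb|a IHa|a IHa|y a IHa] //= h.
- by split; [apply: IHa|apply: IHb] => y yb; apply: h; rewrite leq_max yb ?orbT.
- move=> _; split; first by apply: h; rewrite leq_max leqnn.
  by apply: IHa => z zb; apply: h; rewrite leq_max zb orbT.
Qed.

(* The variable [x] only stands for the free occurrences of [j], hence never
   lies in the scope of a quantifier on [j]. *)
Lemma correct_subst_back x j s phi : (bound phi <= x)%N ->
  (forall n, occurs x (s n) -> n = j) ->
  correct_subst x (Var j) (psubst s phi).
Proof.
elim: phi s => [P ts|a IHa b IHb|a IHa|a IHa|y a IHa] s //=.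
- by rewrite geq_max => /andP[ax bx] h; split; [apply: IHa|apply: IHb].
- by move=> ax h; apply: IHa.
- by move=> ax h; apply: IHa.
- rewrite geq_max => /andP[yx ax] h.
  have h' n : occurs x ([eta s with y |-> Var y] n) -> n <> y /\ n = j.
    rewrite /=; case: eqVneq => [_ /= xy|/eqP ny /h nj]; last by split.
    by rewrite xy ltnn in yx.
  move=> [_ /free_psubst[n na /h'[ny nj]]]; split=> [yj|]; first by apply: ny; rewrite nj.
  by apply: IHa => // m /h'[].
Qed.

(** All quantified subformulas are closed, so no substitution can cause capture. The metric axioms
    have this form, their only quantifiers being those of dyadic constants. *)
Fixpoint flat phi : Prop :=
  match phi with
  | Atom _ _ => True
  | Dot a b => flat a /\ flat b
  | Neg a | Half a => flat a
  | Sup y a => forall x, ~ free x (Sup y a)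
  end.

Lemma flat_psubst s phi : flat phi -> flat (psubst s phi).
Proof.
elim: phi s => [P ts|a IHa b IHb|a IHa|a IHa|y a IHa] s //=.
- by move=> [/IHa fa /IHb fb].
- exact: IHa.
- exact: IHa.
- move=> h x; rewrite -[_ /\ _]/(free x (psubst s (Sup y a))).
  by move=> /free_psubst[n /h].
Qed.

Lemma flat_correct x t phi : flat phi -> correct_subst x t phi.
Proof.
elim: phi => [P ts|a IHa b IHb|a IHa|a IHa|y a IHa] //=.
- by move=> [/IHa ? /IHb ?].
- by move=> h /h.
Qed.

Lemma occurs_lt t : exists N, forall n, occurs n t -> (n < N)%N.
Proof.
elim: t => [x|f ts IH] /=; first by exists x.+1 => n ->.
have [N hN] := choice IH; exists (\max_i N i) => n [i ni].
by apply: (leq_trans (hN i n ni)); exact: leq_bigmax.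
Qed.

Lemma free_lt phi : exists N, forall n, free n phi -> (n < N)%N.
Proof.
elim: phi => [P ts|a [N hN] b [M hM]|//|//|y a [N hN]] /=.
- have [N hN] := choice (fun i => occurs_lt (ts i)).
  exists (\max_i N i) => n [i ni].
  by apply: (leq_trans (hN i n ni)); exact: leq_bigmax.
- by exists (maxn N M) => n [/hN|/hM] h; rewrite leq_max h ?orbT.
- by exists N => n [_ /hN].
Qed.

Lemma FOne_closed n : ~ free n (@FOne R L).
Proof. by move=> /= [] [n0 [_]]. Qed.

Lemma psubst_FOne s : psubst s FOne = FOne.
Proof. by apply: psubst_id => n /FOne_closed. Qed.

Lemma FPow2_closed k n : ~ free n (@FPow2 R L k).
Proof. elim: k => [|k IHk]; [exact: FOne_closed | exact: IHk]. Qed.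

Lemma dform_closed (e : @dexp) n : ~ free n (@dform R L e).
Proof. by elim: e => [|e1 h1 e2 h2|//|//] /=; [exact: FOne_closed | case]. Qed.

Lemma psubst_dform s (e : dexp) : psubst s (dform e) = dform e.
Proof. by apply: psubst_id => n /dform_closed. Qed.

Lemma flat_dform (e : dexp) : flat (@dform R L e).
Proof. by elim: e => //= ; split => x [n0 [_]]. Qed.

Lemma bound_dform (e : dexp) : (bound (@dform R L e) <= 1)%N.
Proof. by elim: e => //= e1 h1 e2 h2; rewrite geq_max h1. Qed.

End Substitution.

(** * Generalization, deduction and conservativity of witnesses *)

Section Derivations.
Context {R : realType} {L : signature R}.
Implicit Types (G : set (formula L)) (phi a : formula L).

Lemma proves_theory G : theory (@Dot R L) (@Neg R L) (@Half R L) (proves G).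
Proof.
split=> [a b|a b c|a b|a b|a|a|a b]; try exact: proves_mp; apply: proves_axiom.
- exact: A1.
- exact: A2.
- exact: A3.
- exact: A4.
- exact: A5.
- exact: A6.
Qed.

Lemma proves_sub G G' phi : G `<=` G' -> proves G phi -> proves G' phi.
Proof.
move=> GG'; elim=> {phi} [phi|phi|phi psi _ IH1 _ IH2].
- exact: proves_axiom.
- by move/GG'; exact: proves_hyp.
- exact: proves_mp IH1 IH2.
Qed.

Lemma proves_FOne G phi : proves G FOne -> proves G phi.
Proof.
have HG := proves_theory G.
by move=> h; exact: (tle_mp HG (le_one _ HG phi) h).
Qed.

(** Axioms are closed under generalization, (A9) generalizes hypotheses, and (A7) passes through
    modus ponens. *)
Lemma generalization G x phi : (forall psi, G psi -> ~ free x psi) ->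
  proves G phi -> proves G (Sup x phi).
Proof.
move=> xG; elim=> {phi} [phi ax|phi Gphi|phi psi _ IH1 _ IH2].
- exact/proves_axiom/Ageneralization.
- exact: proves_mp (proves_hyp Gphi) (proves_axiom _ (A9 (xG _ Gphi))).
- apply: proves_mp IH1 _; apply: proves_mp IH2 _.
  by apply: proves_axiom; exact: A7.
Qed.

Lemma instantiation G x t phi : (forall psi, G psi -> ~ free x psi) ->
  correct_subst x t phi -> proves G phi -> proves G (subst x t phi).
Proof.
move=> xG c /(generalization xG) /proves_mp; apply.
exact/proves_axiom/A8.
Qed.

Lemma deduction G th phi : proves (G `|` [set th]) phi ->
  extend (@Dot R L) (proves G) th phi.
Proof.
have HG := proves_theory G.
elim=> {phi} [phi ax|phi [Gphi|->]|phi psi _ IH1 _ IH2].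
- exact/sub_extend/proves_axiom.
- exact/sub_extend/proves_hyp.
- exact: (extend_mem HG).
- exact: (extend_mp HG IH1 IH2).
Qed.

Lemma foldl_mono G l a b : proves G (Dot a b) ->
  proves G (Dot (foldl (@Dot R L) a l) (foldl (@Dot R L) b l)).
Proof.
elim: l a b => [//|c l IHl] a b ab; apply: IHl.
exact: (dot_mono (proves_theory G)).
Qed.

Lemma foldl_exch G l a b :
  proves G (Dot (Dot (foldl (@Dot R L) a l) b) (foldl (@Dot R L) (Dot a b) l)).
Proof.
have HG := proves_theory G.
elim: l a => [|c l IHl] a /=; first exact: (tlexx HG).
apply: (tle_trans HG) (IHl _) _; apply: foldl_mono; exact: (dot_exch HG).
Qed.

(** The hypotheses form an indexed family, so that the finitely many used can be traced back to
    their indices, here formulas before a renaming. *)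
Lemma finite_deduction {I : Type} (g : I -> formula L) (P : set I) phi :
  proves (g @` P) phi -> exists2 l : seq I, (forall i, List.In i l -> P i) &
    proves set0 (foldl (@Dot R L) phi (map g l)).
Proof.
have H0 := proves_theory set0.
elim=> {phi} [phi ax|_ [i Pi <-]|phi psi _ [l1 P1 h1] _ [l2 P2 h2]].
- by exists [::] => //; exact: proves_axiom.
- by exists [:: i] => [j [<-|]//|] /=; exact: (tlexx H0).
- exists (l2 ++ l1); first by move=> i /(@List.in_app_or _ _ _ _)[/P2|/P1].
  rewrite map_cat foldl_cat; apply: proves_mp h1 _; apply: foldl_mono.
  exact: (tle_mp H0 (foldl_exch _ _ _ _) h2).
Qed.

Lemma foldl_proves G l phi : (forall psi, List.In psi l -> G psi) ->
  proves G (foldl (@Dot R L) phi l) -> proves G phi.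
Proof.
elim: l phi => [//|c l IHl] phi /= lG h.
have := IHl (Dot phi c) (fun psi psil => lG _ (or_intror psil)) h.
by apply: proves_mp; apply: proves_hyp; apply: lG; left.
Qed.

Lemma psubst_foldl s l phi : psubst s (foldl (@Dot R L) phi l) =
  foldl (@Dot R L) (psubst s phi) (map (psubst s) l).
Proof. by elim: l phi => [//|c l IHl] phi /=; rewrite IHl. Qed.

Lemma bound_foldl K l phi : (bound phi <= K)%N ->
  (forall psi, List.In psi l -> (bound psi <= K)%N) ->
  (bound (foldl (@Dot R L) phi l) <= K)%N.
Proof.
elim: l phi => [//|c l IHl] phi /= phiK lK; apply: IHl => [|psi psil].
  by rewrite geq_max phiK; apply: lK; left.
by apply: lK; right.
Qed.

(** The variables are put back one at a time: [K + j] is never bound and stands only for [j], so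
    replacing it by [j] is correct. *)
Lemma unshift K phi : (bound phi <= K)%N ->
  proves set0 (psubst (fun n => Var (K + n)) phi) -> proves set0 phi.
Proof.
move=> phiK h; have [N hN] := free_lt phi.
pose s j n : term L := Var (if (n < j)%N then n else K + n)%N.
suff : forall j, proves set0 (psubst (s j) phi).
  by move/(_ N); rewrite psubst_id// => n /hN; rewrite /s => ->.
elim=> [|j IHj]; first exact: h.
have -> : psubst (s j.+1) phi = subst (K + j) (Var j) (psubst (s j) phi).
  symmetry; apply: subst_psubst; last by left; lia.
  move=> n _; rewrite /s /=; case: ltnP => nj; case: ltnP => nj';
    case: eqP => e; congr Var; lia.
apply: instantiation => //; apply: correct_subst_back; first lia.
by move=> n /=; case: ltnP => nj; lia.
Qed.

(** The terms only contain variables below [K], so replacing the variables from [K] on one after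
    another amounts to a simultaneous substitution. *)
Lemma flat_instance G K N (t : nat -> term L) phi : flat phi ->
  (bound phi <= K)%N -> (forall j n, occurs n (t j) -> (n < K)%N) ->
  proves set0 phi ->
  proves G (psubst (fun x => if (K <= x < K + N)%N then t (x - K)%N else Var x) phi).
Proof.
move=> fphi phiK tK h; apply: (@proves_sub set0) => //.
elim: N => [|N IHN].
  by rewrite psubst_id// => n _; case: ifP => //; lia.
set s := (X in psubst X) in IHN; set s' := (X in psubst X).
have -> : psubst s' phi = subst (K + N) (t N) (psubst s phi).
  symmetry; apply: subst_psubst; last by left; lia.
  move=> n _; rewrite /s' /s; case: ifP => n1; case: ifP => n2; try lia.
  - by rewrite subst_term_id// => /tK; lia.
  - rewrite /=; case: eqP => n3; last lia.
    by rewrite n3 addKn.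
  - by rewrite /=; case: eqP => n3 //; lia.
apply: instantiation => //; exact/flat_correct/flat_psubst.
Qed.

(* Were the witnessing axiom refutable, then [psi y] would be at most
   [sup psi - 2^-k] for the fresh variable [y], hence so would [sup psi]. *)
Lemma witness_conservative G s x y a : (forall psi, G psi -> ~ free y psi) ->
  (bound (Sup x a) <= y)%N -> (forall n, ~ occurs y (s n)) ->
  (forall n, ~ occurs x (s n)) ->
  proves (G `|` [set Dot (psubst s (Sup x a)) (psubst [eta s with x |-> Var y] a)])
    FOne -> proves G FOne.
Proof.
move=> yG; rewrite /= geq_max => /andP[xy ay] ys xs.
have HG := proves_theory G.
set ax := psubst [eta s with x |-> Var x] a; set f := psubst _ a.
have f_ax : f = subst x (Var y) ax.
  symmetry; apply: subst_psubst; last first.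
    by right=> n nx /=; case: eqP => // _; exact: xs.
  by move=> n _ /=; case: eqP => _ /=; rewrite ?eqxx// subst_term_id//; exact: xs.
have ax_f : ax = subst y (Var x) f.
  symmetry; apply: subst_psubst; last by left.
  by move=> n _ /=; case: eqP => _ /=; rewrite ?eqxx// subst_term_id//; exact: ys.
have f_sup : tle (@Dot R L) (proves G) f (Sup x ax).
  rewrite f_ax; apply/proves_axiom/A8/correct_subst_bound => z.
  by rewrite bound_psubst /= => za zy; rewrite zy ltnNge ay in za.
(* Renaming of the bound variable: [ax] is [f] with [x] for [y], so (A8) puts it below [Sup y f],
   where [x] is not free; then (A7) and (A9) apply. *)
have sup_sup : tle (@Dot R L) (proves G) (Sup x ax) (Sup y f).
  have A : axiom (Sup x (Dot ax (Sup y f))).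
    apply: Ageneralization; rewrite {1}ax_f; apply: A8.
    apply: correct_subst_back => // n /=; case: eqP => // _ /ys//.
  have B : ~ free x (Sup y f).
    move=> [_ /free_psubst[n _ /=]]; case: eqP => [_ /= xy'|_ /xs//].
    by rewrite xy' ltnn in xy.
  apply: (tle_trans HG) (proves_axiom _ (A9 B)).
  by apply: proves_mp (proves_axiom _ A) _; apply/proves_axiom/A7.
(* The gap [2^-k] passes from [f] to [Sup y f] by generalizing over [y], hence to the supremum
   itself, and makes [2^-k] provable. *)
move=> /deduction /(extend_dot_one HG f_sup)[k ks fk].
apply: (pow2_thm HG (n := k)); apply: (le_dot_self HG ks).
apply: (tle_trans HG) sup_sup _.
have B : ~ free y (Dot (Sup x ax) (FPow2 k)).
  move=> [h|]; last exact: FPow2_closed.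
  have : free y (psubst s (Sup x a)) := h.
  by move=> /free_psubst[n _ /ys].
apply: (tle_trans HG) (proves_axiom _ (A9 B)).
apply: proves_mp (generalization yG fk) _.
by apply/proves_axiom/A7.
Qed.

End Derivations.

(** * Soundness and the diagram of a structure *)

Section Soundness.
Context {R : realType} {L : signature R} (M : prestructure L).
Implicit Types (s : nat -> carrier M) (phi a : formula L) (t u : term L).

Variant max0_spec (x : R) : R -> Prop :=
| Max0le of x <= 0 : max0_spec x 0
| Max0ge of 0 <= x : max0_spec x x.

Lemma max0P x : max0_spec x (Num.max x 0).
Proof.
by have [x0|x0] := leP x 0; constructor => //; exact: ltW.
Qed.

Lemma value01 s phi : 0 <= value s phi <= 1.
Proof.
elim: phi s => [P ts|a IHa b IHb|a IHa|a IHa|x a IHa] s /=.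
- exact: rel_int01.
- by move: (IHa s) (IHb s); case: max0P; lra.
- by move: (IHa s); lra.
- by move: (IHa s); lra.
- set A := (X in sup X).
  have A1 : ubound A 1 by move=> _ [m _ <-]; case/andP: (IHa [eta s with x |-> m]).
  have [m] := carrier_nonempty M; set r := value [eta s with x |-> m] a.
  have Ar : A r by exists m.
  have /andP[r0 _] := IHa [eta s with x |-> m].
  apply/andP; split; last by apply: ge_sup => //; exists r.
  by apply: (le_trans r0); apply: ub_le_sup => //; exists 1.
Qed.

Lemma value_Dot s a b :
  value s (Dot a b) = Num.max (value s a - value s b) 0.
Proof. by []. Qed.

Lemma value_le_Sup s x a m : value [eta s with x |-> m] a <= value s (Sup x a).
Proof.
apply: ub_le_sup => /=; last by exists m.
by exists 1 => _ [m' _ <-]; case/andP: (value01 [eta s with x |-> m'] a).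
Qed.

Lemma value_Sup_le s x a r : (forall m, value [eta s with x |-> m] a <= r) ->
  value s (Sup x a) <= r.
Proof.
move=> h; apply: ge_sup; last by move=> _ [m _ <-].
by have [m] := carrier_nonempty M; exists (value [eta s with x |-> m] a), m.
Qed.

Lemma term_value_ext s s' t : (forall n, occurs n t -> s n = s' n) ->
  term_value s t = term_value s' t.
Proof.
elim: t => [x|f ts IH] /= h; first exact: h.
by congr fun_int; apply/funext => i; apply: IH => n ni; apply: h; exists i.
Qed.

Lemma value_ext s s' phi : (forall n, free n phi -> s n = s' n) ->
  value s phi = value s' phi.
Proof.
elim: phi s s' => [P ts|a IHa b IHb|a IHa|a IHa|x a IHa] s s' /= h.
- congr rel_int; apply/funext => i; apply: term_value_ext => n ni.
  by apply: h; exists i.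
- by rewrite (IHa s s') ?(IHb s s')// => n hn; apply: h; [right|left].
- by rewrite (IHa s s').
- by rewrite (IHa s s').
- congr (sup (image setT _)); apply/funext => m; apply: IHa => n na /=.
  by case: eqP => // nx; exact: h.
Qed.

Lemma term_value_subst s x t u :
  term_value s (subst_term x t u) = term_value [eta s with x |-> term_value s t] u.
Proof.
elim: u => [y|f ts IH] /=; first by case: eqP.
by congr fun_int; apply/funext.
Qed.

Lemma subst_id x t phi : ~ free x phi -> subst x t phi = phi.
Proof.
elim: phi => [P ts|a IHa b IHb|a IHa|a IHa|y a IHa] /= h.
- by congr Atom; apply/funext => i; apply: subst_term_id => xi; apply: h; exists i.
- by rewrite IHa ?IHb// => h'; apply: h; [right|left].
- by rewrite IHa.
- by rewrite IHa.
- by case: eqP => // yx; rewrite IHa// => xa; apply: h; split=> // xy; exact: yx.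
Qed.

Lemma value_subst s x t phi : correct_subst x t phi ->
  value s (subst x t phi) = value [eta s with x |-> term_value s t] phi.
Proof.
elim: phi s => [P ts|a IHa b IHb|a IHa|a IHa|y a IHa] s /=.
- by move=> _; congr rel_int; apply/funext => i; exact: term_value_subst.
- by move=> [ca cb]; rewrite IHa ?IHb.
- by move=> ca; rewrite IHa.
- by move=> ca; rewrite IHa.
- move=> c; case: eqVneq => [yx|/eqP yx] /=.
    congr (sup (image setT _)); apply/funext => m; apply: value_ext => n _ /=.
    by rewrite yx; case: eqP.
  (* Correctness says nothing about a quantifier whose scope lacks [x], but there the substitution
     is void. *)
  have [xa|xa] := pselect (free x a); last first.
    rewrite subst_id//; congr (sup (image setT _)); apply/funext => m.
    apply: value_ext => n na /=; case: eqP => // _; case: eqP => // nx.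
    by rewrite nx in na.
  have [|yt ca] := c; first by split=> // /esym.
  congr (sup (image setT _)); apply/funext => m; rewrite IHa//.
  apply: value_ext => n _ /=; case: eqP => [nx|//].
  rewrite nx; case: eqP => [xy|_]; first by case: yx.
  apply: term_value_ext => k kt /=; case: eqP => // ky.
  by rewrite ky in kt.
Qed.

Lemma value_FOne s : value s FOne = 1.
Proof. by rewrite /= subrr maxxx subr0. Qed.

Lemma value_FPow2 s n : value s (FPow2 n) = (2 ^+ n)^-1.
Proof.
elim: n => [|n IHn]; first by rewrite expr0 invr1; exact: value_FOne.
by rewrite /= IHn exprS invfM mulrC.
Qed.

Lemma value_dform s (e : dexp) : value s (dform e) = dval e.
Proof.
by elim: e => [|a IHa b IHb|a IHa|a IHa]; [exact: value_FOne | move=> /=..];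
  rewrite ?IHa ?IHb.
Qed.

Lemma value_FDyad s (q : R) : dyadic q -> value s (FDyad q) = q.
Proof. by move=> dq; rewrite value_dform dval_dyadic_name. Qed.

Lemma term_value_pair_args n s t u :
  (fun i : 'I_n => term_value s (pair_args t u i)) =
  pair_args (term_value s t) (term_value s u).
Proof. by apply/funext => i; rewrite /pair_args; case: ifP. Qed.

Lemma value_FAnd s phi psi :
  value s phi = 0 \/ value s psi = 0 -> value s (FAnd phi psi) = 0.
Proof.
move: (value01 s phi) (value01 s psi) => /= p01 q01.
by move=> [->|->]; do ![case: max0P]; move=> *; lra.
Qed.

Lemma value_modify (I : eqType) s (xs : I -> nat) i z :
  (fun j => s ([eta xs with i |-> z] j)) = [eta (fun j => s (xs j)) with i |-> s z].
Proof. by apply/funext => j /=; case: eqP. Qed.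

Lemma value_axiom phi s : axiom phi -> value s phi = 0.
Proof.
move=> ax; elim: ax s => {phi}.
- move=> a b s /=; move: (value01 s a) (value01 s b).
  by do ![case: max0P]; move=> *; lra.
- move=> a b c s /=; move: (value01 s a) (value01 s b) (value01 s c).
  by do ![case: max0P]; move=> *; lra.
- move=> a b s /=; move: (value01 s a) (value01 s b).
  by do ![case: max0P]; move=> *; lra.
- move=> a b s /=; move: (value01 s a) (value01 s b).
  by do ![case: max0P]; move=> *; lra.
- move=> a s /=; move: (value01 s a).
  by do ![case: max0P]; move=> *; lra.
- move=> a s /=; move: (value01 s a).
  by do ![case: max0P]; move=> *; lra.
- move=> x a b s.
  have : value s (Sup x b) <= value s (Sup x a) + value s (Sup x (Dot b a)).
    apply: value_Sup_le => m.
    have := value_le_Sup s x a m; have := value_le_Sup s x (Dot b a) m.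
    rewrite value_Dot; case: max0P; lra.
  move: (value01 s (Sup x (Dot b a))).
  rewrite !value_Dot.
  by do ![case: max0P]; move=> *; lra.
- move=> x t a c s.
  have := value_le_Sup s x a (term_value s t); rewrite -value_subst//.
  by rewrite value_Dot; case: max0P => *; lra.
- move=> x a xa s.
  have : value s (Sup x a) <= value s a.
    apply: value_Sup_le => m; rewrite (@value_ext [eta s with x |-> m] s)//.
    by move=> n na /=; case: eqP => // nx; rewrite nx in na.
  by rewrite value_Dot; case: max0P => *; lra.
- by move=> d x dL s /=; rewrite term_value_pair_args metric_refl.
- move=> d x y dL s /=; rewrite !term_value_pair_args metric_sym// subrr.
  by rewrite maxxx.
- move=> d x y z dL s /=; rewrite !term_value_pair_args.
  have := metric_triangle dL (s x) (s y) (s z).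
  move: (@rel_int01 _ _ M d (pair_args (s y) (s z))).
  by do ![case: max0P]; move=> *; lra.
- move=> d f i xs z w eps r q dL eps01 dr dq epsr qd s.
  apply: value_FAnd; rewrite /= !value_FDyad// !term_value_pair_args /=.
  (* Either the distance is at least [q] and the first member vanishes, or it is below the modulus
     and the second one does. *)
  rewrite !value_modify; case: (leP q (@rel_int _ _ M d (pair_args (s z) (s w)))) => h.
    by left; case: max0P => *; lra.
  right; have := @fun_ucont _ _ M _ dL f i (fun j => s (xs j)) _ _ _ eps01
    (lt_trans h qd).
  by case: max0P => *; lra.
- move=> d P i xs z w eps r q dL eps01 dr dq epsr qd s.
  apply: value_FAnd; rewrite /= !value_FDyad// !term_value_pair_args /=.
  rewrite !value_modify; case: (leP q (@rel_int _ _ M d (pair_args (s z) (s w)))) => h.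
    by left; case: max0P => *; lra.
  right; have := @rel_ucont _ _ M _ dL P i (fun j => s (xs j)) _ _ _ eps01
    (lt_trans h qd).
  by do ![case: max0P]; move=> *; lra.
- move=> x a _ IH s; apply/eqP; rewrite eq_le.
  case/andP: (value01 s (Sup x a)) => -> _; rewrite andbT.
  by apply: value_Sup_le => m; rewrite IH.
Qed.

Lemma soundness s G phi : models s G -> proves G phi -> value s phi = 0.
Proof.
move=> sG; elim=> {phi} [phi /value_axiom//|phi /sG//|phi psi _ IH1 _ /=].
by rewrite IH1; move: (value01 s psi); case: max0P; lra.
Qed.

End Soundness.

(** * The expansion of a structure by names for its elements *)

Section Diagram.
Context {R : realType} {L : signature R} (M : prestructure L).

Definition diagram : signature R.
Proof.
refine (@Signature R (rel_symb L) (fun_symb L + carrier M)%type (rel_nonempty L)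
  (@rel_arity R L) (fun f => if f is inl g then fun_arity g else 0%N)
  (@rel_mod R L) (fun f => if f is inl g then fun_mod g else fun _ => id)
  (@rel_mod01 R L) _ (metric L) (@metric_arity R L)).
by move=> [f|//]; exact: fun_mod01.
Defined.

Definition diagram_ext : sig_ext L diagram.
Proof.
refine (@SigExt R L diagram id inl _ _ _ _ _ _ _) => //.
- by move=> f g [].
- by rewrite /=; case: metric.
Defined.

Definition diagram_fun (f : fun_symb diagram) :
    ('I_(fun_arity f) -> carrier M) -> carrier M :=
  match f with
  | inl g => @fun_int R L M g
  | inr m => fun=> m
  end.

Definition diagram_structure : prestructure diagram.
Proof.
refine (@Prestructure R diagram (carrier M) (carrier_nonempty M) diagram_fun
  (@rel_int R L M) (@rel_int01 R L M) (@metric_refl R L M) (@metric_sym R L M)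
  (@metric_triangle R L M) _ (@rel_ucont R L M)).
move=> d dL [f|m] i; first exact: (@fun_ucont _ _ M _ dL f i).
by case: i.
Defined.

Lemma term_value_emb (s : nat -> carrier M) (t : term L) :
  term_value (M := diagram_structure) s (emb_term diagram_ext t) = term_value s t.
Proof.
elim: t => [//|f ts IH] /=; congr fun_int; apply/funext => i.
by rewrite IH; congr (term_value s (ts _)); exact: val_inj.
Qed.

Lemma value_emb (s : nat -> carrier M) (phi : formula L) :
  value (M := diagram_structure) s (emb_formula diagram_ext phi) = value s phi.
Proof.
elim: phi s => [P ts|a IHa b IHb|a IHa|a IHa|x a IHa] s /=;
  rewrite ?IHa ?IHb//.
- congr rel_int; apply/funext => i; rewrite term_value_emb.
  by congr (term_value s (ts _)); exact: val_inj.
- by congr (sup (image setT _)); apply/funext => m; rewrite IHa.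
Qed.

(** Soundness makes the set deductively closed, so in (i) the value is below every [2^-n]; (ii) is
    the linearity of the reals. *)
Lemma theory_maximal_consistent (s : nat -> carrier M) :
  maximal_consistent [set phi | value (M := diagram_structure) s phi = 0].
Proof.
have sound phi := @soundness R diagram diagram_structure s
  [set phi | value (M := diagram_structure) s phi = 0] phi (fun _ => id).
split=> [all|phi h|phi psi] /=.
- have := sound _ (all FOne); rewrite value_FOne => /eqP.
  by rewrite oner_eq0.
- apply/eqP; rewrite eq_le; case/andP: (value01 (M := diagram_structure) s phi).
  move=> -> _; rewrite andbT; apply: ler_pow2 => n.
  have := sound _ (h n); rewrite value_Dot value_FPow2.
  have : 0 < (2 ^+ n)^-1 :> R by rewrite invr_gt0 exprn_gt0.
  by case: max0P => *; lra.
- case: (leP (value (M := diagram_structure) s phi)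
    (value (M := diagram_structure) s psi)) => h;
    [left|right]; case: max0P => *; lra.
Qed.

(** If the supremum is at most [q], any constant serves; otherwise some element gives a value above
    [q], hence above [p], and its name is taken. *)
Lemma theory_henkin_complete (s : nat -> carrier M) :
  henkin_complete [set phi | value (M := diagram_structure) s phi = 0].
Proof.
move=> phi x p q dp dq pq.
case: (leP (value (M := diagram_structure) s (Sup x phi)) q) => h.
  have [m] := carrier_nonempty M; exists (inr m) => //.
  apply: value_FAnd; left; rewrite value_Dot value_FDyad//.
  by case: max0P => *; lra.
have [|_ [m _ <-] qm] := sup_gt _ h.
  have [m] := carrier_nonempty M.
  by exists (value (M := diagram_structure) [eta s with x |-> m] phi), m.
exists (inr m) => //; apply: value_FAnd; right.
rewrite value_Dot value_FDyad// value_subst.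
  rewrite [term_value _ _]/=.
  have : q < value (M := diagram_structure) [eta s with x |-> m] phi := qm.
  by case: max0P => *; lra.
by apply: correct_subst_bound => y _ [[]].
Qed.

Lemma henkin_of_model (G : set (formula L)) (s : nat -> carrier M) :
  models s G ->
  exists (Lc : signature R) (h : sig_ext L Lc) (D : set (formula Lc))
         (N : prestructure Lc) (s' : nat -> carrier N),
    [/\ maximal_consistent D, henkin_complete D,
        emb_formula h @` G `<=` D & models s' D].
Proof.
move=> sG; exists diagram, diagram_ext,
  [set phi | value (M := diagram_structure) s phi = 0], diagram_structure, s.
split=> //.
- exact: theory_maximal_consistent.
- exact: theory_henkin_complete.
- by move=> _ [phi Gphi <-] /=; rewrite value_emb; exact: sG.
Qed.

End Diagram.

(** * Instances of the metric axioms *)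

Section TermInstances.
Context {R : realType} {L : signature R}.
Implicit Types (G : set (formula L)) (t u : term L).

Lemma occurs_nth_lt (l : seq (term L)) :
  exists2 K, (0 < K)%N & forall j n, occurs n (nth (Var 0) l j) -> (n < K)%N.
Proof.
elim: l => [|t l [K K0 hK]]; first by exists 1%N => // j n; rewrite nth_nil => /= ->.
have [N hN] := occurs_lt t; exists (maxn K N); first by rewrite leq_max K0.
by move=> [|j] n /=; [move/hN | move/hK] => h; rewrite leq_max h ?orbT.
Qed.

(** The metric axioms speak of variables only. They are taken at variables from some [K] on, beyond
    those of the terms in [l], for which the terms are then substituted; [K] is positive because
    dyadic constants bind the variable 0. *)
Lemma axiom_instance G (l : seq (term L)) (phi : nat -> formula L) :
  (forall K, flat (phi K)) -> (forall K, (bound (phi K) <= 1)%N) ->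
  (forall K, axiom (phi K)) ->
  exists (K : nat) (s : nat -> term L),
    (forall j, (j < size l)%N -> s (K + j)%N = nth (Var 0) l j) /\
    proves G (psubst s (phi K)).
Proof.
move=> phi_flat phi1 ax; have [K K0 hK] := occurs_nth_lt l; exists K.
exists (fun x => if (K <= x < K + size l)%N then nth (Var 0) l (x - K) else Var x).
split=> [j jl|]; first by rewrite leq_addr ltn_add2l jl addKn.
apply: (@flat_instance _ _ G K (size l) (nth (Var 0) l)) => //.
  exact: leq_trans (phi1 K) K0.
exact: proves_axiom.
Qed.

Lemma psubst_pair_args n (s : nat -> term L) t u :
  (fun i : 'I_n => psubst_term s (pair_args t u i)) =
  pair_args (psubst_term s t) (psubst_term s u).
Proof. by apply/funext => i; rewrite /pair_args; case: ifP. Qed.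

Lemma psubst_modify n (s : nat -> term L) (xs : 'I_n -> nat) i z :
  (fun j => s (if j == i then z else xs j)) =
  [eta (fun j => s (xs j)) with i |-> s z].
Proof. by apply/funext => j /=; case: eqP. Qed.

Definition distance (d : rel_symb L) t u : formula L := Atom (P := d) (pair_args t u).

Lemma distance_refl G d t : metric L = Some d -> proves G (distance d t t).
Proof.
move=> dL.
have [||K|K [s [sE]]] := @axiom_instance G [:: t] (fun K => dist d K K) => //.
  exact: A10.
by rewrite /= psubst_pair_args /= -[K]addn0 sE.
Qed.

Lemma distance_sym G d t u : metric L = Some d ->
  proves G (Dot (distance d t u) (distance d u t)).
Proof.
move=> dL.
have [||K|K [s [sE]]] := @axiom_instance G [:: t; u]
  (fun K => Dot (dist d (K + 0) (K + 1)) (dist d (K + 1) (K + 0))) => //.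
  exact: A11.
by rewrite /= !psubst_pair_args /= !sE.
Qed.

Lemma distance_triangle G d t u v : metric L = Some d ->
  proves G (Dot (Dot (distance d t v) (distance d t u)) (distance d u v)).
Proof.
move=> dL.
have [||K|K [s [sE]]] := @axiom_instance G [:: t; u; v]
  (fun K => Dot (Dot (dist d (K + 0) (K + 2)) (dist d (K + 0) (K + 1)))
                (dist d (K + 1) (K + 2))) => //.
  exact: A12.
by rewrite /= !psubst_pair_args /= !sE.
Qed.

(** Layout of the fresh variables in (A13) and (A14): first the two compared entries, then the full
    family of arguments. *)
Lemma nth_args n (a : 'I_n -> term L) t u (s : nat -> term L) K :
  (forall j, (j < size [:: t, u & map a (enum 'I_n)])%N ->
    s (K + j)%N = nth (Var 0) [:: t, u & map a (enum 'I_n)] j) ->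
  [/\ s (K + 0)%N = t, s (K + 1)%N = u & (fun j : 'I_n => s (K + j.+2)%N) = a].
Proof.
move=> sE; split; rewrite ?sE//; apply/funext => j; rewrite sE/=.
  by rewrite (nth_map j) ?size_enum_ord// nth_ord_enum.
by rewrite size_map size_enum_ord !ltnS.
Qed.

Lemma fun_modulus G d (f : fun_symb L) (i : 'I_(fun_arity f))
    (a : 'I_(fun_arity f) -> term L) t u
    (eps r q : R) :
  metric L = Some d -> 0 < eps <= 1 -> dyadic r -> dyadic q ->
  eps < r -> q < fun_mod f i eps ->
  proves G (FAnd (Dot (FDyad q) (distance d t u))
    (Dot (distance d (App [eta a with i |-> t]) (App [eta a with i |-> u]))
         (FDyad r))).
Proof.
move=> dL eps01 dr dq epsr qd.
have [K|K|K|K [s [/nth_args[sz sw sxs]]]] := @axiom_instance G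
  [:: t, u & map a (enum 'I_(fun_arity f))] (fun K => FAnd
      (Dot (FDyad q) (dist d (K + 0) (K + 1)))
      (Dot (Atom (P := d) (pair_args
              (App (fun j => Var
                ([eta (fun j : 'I__ => K + j.+2)%N with i |-> (K + 0)%N] j)))
              (App (fun j => Var
                ([eta (fun j : 'I__ => K + j.+2)%N with i |-> (K + 1)%N] j)))))
           (FDyad r))).
- by repeat split; exact: flat_dform.
- by rewrite /= !geq_max !bound_dform.
- exact: A13 dL eps01 dr dq epsr qd.
- rewrite /= !psubst_pair_args !psubst_dform /=.
  by rewrite !psubst_modify sxs sz sw.
Qed.

Lemma rel_modulus G d (P : rel_symb L) (i : 'I_(rel_arity P))
    (a : 'I_(rel_arity P) -> term L) t u
    (eps r q : R) :
  metric L = Some d -> 0 < eps <= 1 -> dyadic r -> dyadic q ->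
  eps < r -> q < rel_mod P i eps ->
  proves G (FAnd (Dot (FDyad q) (distance d t u))
    (Dot (Dot (Atom [eta a with i |-> t]) (Atom [eta a with i |-> u]))
         (FDyad r))).
Proof.
move=> dL eps01 dr dq epsr qd.
have [K|K|K|K [s [/nth_args[sz sw sxs]]]] := @axiom_instance G
  [:: t, u & map a (enum 'I_(rel_arity P))] (fun K => FAnd
      (Dot (FDyad q) (dist d (K + 0) (K + 1)))
      (Dot (Dot
              (Atom (fun j => Var
                ([eta (fun j : 'I__ => K + j.+2)%N with i |-> (K + 0)%N] j)))
              (Atom (fun j => Var
                ([eta (fun j : 'I__ => K + j.+2)%N with i |-> (K + 1)%N] j))))
           (FDyad r))).
- by repeat split; exact: flat_dform.
- by rewrite /= !geq_max !bound_dform.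
- exact: A14 dL eps01 dr dq epsr qd.
- rewrite /= !psubst_pair_args !psubst_dform /=.
  by rewrite !psubst_modify sxs sz sw.
Qed.

End TermInstances.

(** With [2^-n] smaller than the gap, the least multiple of [2^-n] above [a] is still below [b]. *)
Lemma dyadic_between {R : realType} (a b : R) : 0 <= a -> a < b -> b <= 1 ->
  exists2 r, dyadic r & a < r < b.
Proof.
move=> a0 ab b1; have ba : 0 < b - a by rewrite subr_gt0.
have [n hn] : exists n, (2 ^+ n)^-1 < b - a.
  exists (Num.Def.archi_bound (b - a)^-1).
  rewrite invf_plt ?posrE ?exprn_gt0//.
  apply: lt_trans (archi_boundP _) _; first by rewrite invr_ge0 ltW.
  by rewrite -natrX ltr_nat ltn_expl.
have ex : exists k, a < k%:R / 2 ^+ n.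
  by exists (2 ^ n)%N; rewrite natrX divff ?expf_neq0 ?pnatr_eq0//;
    exact: lt_le_trans ab b1.
case: (ex_minnP ex) => k ak kmin; exists (k%:R / 2 ^+ n); last first.
  rewrite ak /=; case: k ak kmin => [|k _ kmin].
    by rewrite mul0r ltNge a0.
  have : k%:R / 2 ^+ n <= a by rewrite leNgt; apply/negP => /kmin; rewrite ltnn.
  rewrite -(natr1 k) mulrDl mul1r; move: hn; lra.
exists k, n; split=> //; apply: kmin.
by rewrite natrX divff ?expf_neq0 ?pnatr_eq0//;
    exact: lt_le_trans ab b1.
Qed.

(** * Existence of a model *)

Section ModelExistence.
Context {R : realType} {L : signature R}.

(* [Par n] names the value of the variable [n], and [Wit a x s] an element at
   which [sup_x a] is attained under the assignment [s]. *)
Inductive wterm : Type :=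
| CApp (f : fun_symb L) of ('I_(fun_arity f) -> wterm)
| Par of nat
| Wit of formula L & nat & (nat -> wterm).

Implicit Types (c w : wterm) (l : seq wterm) (a phi : formula L)
  (s : nat -> wterm) (nu : wterm -> nat).

Fixpoint subwit w c : Prop :=
  match c with
  | CApp _ cs => exists i, subwit w (cs i)
  | Par _ => False
  | Wit a x s => w = Wit a x s \/ exists n, subwit w (s n)
  end.

(** The dependence order: the axiom for a witness mentions the witnesses inside its assignment. *)
Definition psubwit w c : Prop :=
  if c is Wit a x s then exists n, subwit w (s n) else False.

Lemma psubwit_sub w c : psubwit w c -> subwit w c.
Proof. by case: c => //= a x s; right. Qed.

Lemma subwit_trans u w c : subwit u w -> subwit w c -> subwit u c.
Proof.
elim: c => [f cs IH|//|a x s IH] /= uw.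
- by move=> [i /(IH i uw)]; exists i.
- by move=> [wE|[n /(IH n uw)]]; [rewrite wE in uw | right; exists n].
Qed.

(** Assignments are infinite families, so no size is available; a structural induction on [c] treats
    all witnesses occurring in [c] at once. *)
Lemma psubwit_irr w : ~ psubwit w w.
Proof.
suff h c v : subwit v c -> ~ psubwit v v.
  by move=> ww; exact: h (psubwit_sub ww) ww.
elim: c v => [f cs IH|//|a x s IH] v /=; first by move=> [i /IH].
move=> [->|[n /IH//]] /= [n h].
by apply: (IH n _ h); exists n.
Qed.

Lemma psubwit_trans u w c : psubwit u w -> psubwit w c -> psubwit u c.
Proof.
by case: c => //= a x s uw [n /(subwit_trans (psubwit_sub uw)) h]; exists n.
Qed.

Lemma exists_maximal l : l <> [::] ->
  exists2 w, List.In w l & forall w', List.In w' l -> ~ psubwit w w'.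
Proof.
elim: l => [//|c [_ _|d l IHl _]].
  by exists c; [left | move=> w' [<-|//]; exact: psubwit_irr].
have [//|w wl wmax] := IHl; have [wc|wc] := pselect (psubwit w c).
  exists c; first by left.
  move=> w' [<-|w'l]; first exact: psubwit_irr.
  by move=> /(psubwit_trans wc); exact: wmax.
by exists w; [right | move=> w' [<-//|]; exact: wmax].
Qed.

Fixpoint translate nu c : term L :=
  match c with
  | CApp f cs => App (fun i => translate nu (cs i))
  | _ => Var (nu c)
  end.

Lemma occurs_translate y nu c : occurs y (translate nu c) ->
  (exists n, y = nu (Par n)) \/ (exists2 w, subwit w c & y = nu w).
Proof.
elim: c => [f cs IH|n|a x s _] /=.
- by move=> [i /IH[|[w wi ->]]]; [left | right; exists w => //; exists i].
- by move=> ->; left; exists n.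
- by move=> ->; right; exists (Wit a x s) => //; left.
Qed.

(* Formulas of [L] with parameters in [wterm] are modelled as functions of an
   interpretation of the parameters by variables. *)
Definition pformula := (wterm -> nat) -> formula L.

Definition pdot (p q : pformula) : pformula := fun nu => Dot (p nu) (q nu).
Definition pneg (p : pformula) : pformula := fun nu => Neg (p nu).
Definition phalf (p : pformula) : pformula := fun nu => Half (p nu).
(** Chosen so that the propositional unit [pneg (pdot pzero pzero)] is convertible to the constant
    function [FOne]. *)
Definition pzero : pformula :=
  fun=> Sup 0%N (Atom (P := unsquash (rel_nonempty L)) (fun=> Var 0%N)).

Definition inst phi s : pformula :=
  fun nu => psubst (fun n => translate nu (s n)) phi.

Lemma translate_modify (I : eqType) nu (s : I -> wterm) x c :
  (fun n => translate nu ([eta s with x |-> c] n)) =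
  [eta (fun n => translate nu (s n)) with x |-> translate nu c].
Proof. by apply/funext => n /=; case: eqP. Qed.

Fixpoint position l c : nat :=
  if l is w :: l' then if `[< w = c >] then 0%N else (position l' c).+1 else 0%N.

Lemma position_lt l c : List.In c l -> (position l c < size l)%N.
Proof.
elim: l => [//|w l IHl] /= h; case: asboolP => // wc.
by rewrite ltnS; apply: IHl; case: h.
Qed.

Lemma position_inj l w c : List.In w l -> position l w = position l c -> w = c.
Proof.
elim: l => [//|v l IHl] /= h; case: asboolP => [->|vw]; case: asboolP => //.
by move=> vc [] /IHl; apply; case: h.
Qed.

(* The members of [l] get distinct names, different from all other names. *)
Definition name K l : wterm -> nat := fun c =>
  if c is Par n then (K + (size l).+1 + n)%N else (K + position l c)%N.

Lemma name_ge K l c : (K <= name K l c)%N.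
Proof. by case: c => *; rewrite /= -?addnA leq_addr. Qed.

Lemma translate_ge y K l c : occurs y (translate (name K l) c) -> (K <= y)%N.
Proof. by move=> /occurs_translate[[n ->]|[w _ ->]]; exact: name_ge. Qed.

(** Members of [l] have positions below [size l]; other terms share the position [size l], and
    parameters come after it. *)
Lemma name_inj K l a x s c : List.In (Wit a x s) l ->
  name K l (Wit a x s) = name K l c -> Wit a x s = c.
Proof.
move=> wl; have := position_lt wl; case: c => [f cs|n|b y s'] /= h.
- by move/addnI; exact: position_inj.
- by rewrite -addnA => /addnI hE; move: h; rewrite hE; lia.
- by move/addnI; exact: position_inj.
Qed.

(** * Provability with parameters and its consistency *)

Context (G : set (formula L)).

(** Names start at [K], so the restriction to bound variables below [K] keeps the renaming free of
    capture. *)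
Definition par_hyps K nu : set (formula L) :=
  (fun phi => inst phi Par nu) @` [set phi | G phi /\ (bound phi <= K)%N].

Definition wit_hyps nu l : set (formula L) :=
  [set th | exists a x s, List.In (Wit a x s) l /\
    th = Dot (inst (Sup x a) s nu) (inst a [eta s with x |-> Wit a x s] nu)].

Definition hyps K l := par_hyps K (name K l) `|` wit_hyps (name K l) l.

(** Provability for all sufficiently large [K] and [l]. Names change with [K] and [l], so two proofs
    can only be combined at a common choice of both. *)
Definition forced (p : pformula) : Prop := exists l0 K0, forall K l,
  (K0 <= K)%N -> List.incl l0 l -> proves (hyps K l) (p (name K l)).

Lemma forced_proves p : (forall nu H, proves H (p nu)) -> forced p.
Proof. by move=> h; exists [::], 0%N. Qed.

Lemma forced_theory : theory pdot pneg phalf forced.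
Proof.
split=> [a b|a b c|a b|a b|a|a|a b].
- by apply: forced_proves => nu H; exact/proves_axiom/A1.
- by apply: forced_proves => nu H; exact/proves_axiom/A2.
- by apply: forced_proves => nu H; exact/proves_axiom/A3.
- by apply: forced_proves => nu H; exact/proves_axiom/A4.
- by apply: forced_proves => nu H; exact/proves_axiom/A5.
- by apply: forced_proves => nu H; exact/proves_axiom/A6.
- move=> [l1 [K1 h1]] [l2 [K2 h2]]; exists (l1 ++ l2), (maxn K1 K2) => K l.
  rewrite geq_max => /andP[K1K K2K] /List.incl_app_inv[l1l l2l].
  exact: proves_mp (h1 K l K1K l1l) (h2 K l K2K l2l).
Qed.

Definition wbound w : nat := if w is Wit a x _ then bound (Sup x a) else 0%N.

Lemma wbound_le l : exists K, forall w, List.In w l -> (wbound w <= K)%N.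
Proof.
elim: l => [|c l [K hK]]; first by exists 0%N.
by exists (maxn (wbound c) K) => w [<-|/hK h]; rewrite leq_max ?leqnn// h orbT.
Qed.

Definition drop_wit w l := List.filter (fun c => ~~ `[< c = w >]) l.

Lemma drop_wit_In w l c : List.In c (drop_wit w l) <-> List.In c l /\ c <> w.
Proof.
rewrite /drop_wit List.filter_In; split=> -[cl /asboolPn cw]; split=> //.
Qed.

Lemma size_drop_wit w l : List.In w l -> (size (drop_wit w l) < size l)%N.
Proof.
have le m : (size (drop_wit w m) <= size m)%N.
  by elim: m => [//|c m IHm] /=; case: ifP => _ //=; exact: leqW.
elim: l => [//|c l IHl] /= h; case: asboolP => [_|cw] /=; first exact: le.
by rewrite ltnS; apply: IHl; case: h.
Qed.

Lemma par_hyps_fresh K l a x s phi : List.In (Wit a x s) l ->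
  par_hyps K (name K l) phi -> ~ free (name K l (Wit a x s)) phi.
Proof.
move=> wl [psi _ <-] /free_psubst[n _ h].
by have := name_inj wl (h : _ = name K l (Par n)).
Qed.

(** The witnesses named in such an axiom are its own and some inside its assignment; the assumption
    on [l0] excludes [Wit a x s] from both. *)
Lemma wit_hyps_fresh K l l0 a x s phi : List.In (Wit a x s) l ->
  (forall c, List.In c l0 -> c <> Wit a x s /\ ~ psubwit (Wit a x s) c) ->
  wit_hyps (name K l) l0 phi -> ~ free (name K l (Wit a x s)) phi.
Proof.
move=> wl wmax [b [y [s' [/wmax[ne nsub] ->]]]].
have fresh n : ~ occurs (name K l (Wit a x s)) (translate (name K l) (s' n)).
  move=> /occurs_translate[[k /(name_inj wl)//]|[c cs /(name_inj wl) cE]].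
  by apply: nsub; exists n; rewrite cE.
move=> [h|].
  have : free (name K l (Wit a x s)) (inst (Sup y b) s' (name K l)) := h.
  by move=> /free_psubst[n _ /fresh].
rewrite /inst translate_modify => /free_psubst[n _].
rewrite [X in occurs _ X]/=; case: eqP => [_ h|_ /fresh//].
by apply: ne; rewrite (name_inj wl (h : _ = name K l (Wit b y s'))).
Qed.

(** The names stay those given by [l] while [l0] shrinks. A witness maximal for dependence has a
    name fresh for all other hypotheses and for its own assignment, so [witness_conservative]
    removes its axiom. *)
Lemma eliminate_witnesses K l l0 : (forall w, List.In w l -> (wbound w <= K)%N) ->
  List.incl l0 l ->
  proves (par_hyps K (name K l) `|` wit_hyps (name K l) l0) FOne ->
  proves (par_hyps K (name K l)) FOne.
Proof.
move=> lK; have [n] := ubnP (size l0); elim: n l0 => // n IHn l0 l0n l0l.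
have [->|l0_neq] := pselect (l0 = [::]).
  by apply: proves_sub => th [//|[a [x [s []]]]].
have [w wl0 wmax] := exists_maximal l0_neq => h.
have drop_incl : List.incl (drop_wit w l0) l by move=> c /drop_wit_In[/l0l].
apply: (IHn (drop_wit w l0)) => //; first exact: leq_trans (size_drop_wit wl0) _.
(* Entries of [l0] that are not witnesses carry no axiom and are simply dropped. *)
case: w => [f cs|m|a x s] in wl0 wmax drop_incl *; try by
  apply: proves_sub h => th [|[b [y [s' [bl ->]]]]]; [left|right;
    exists b, y, s'; split=> //; apply/drop_wit_In].
have wl := l0l _ wl0; have wK := lK _ wl.
apply: (@witness_conservative _ _ _ (fun n => translate (name K l) (s n)) x
  (name K l (Wit a x s)) a) => [phi [|]|||k|].
- exact: par_hyps_fresh.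
- apply: wit_hyps_fresh => // c /drop_wit_In[cl0 cw]; split=> //.
  exact: wmax.
- exact: leq_trans wK (name_ge _ _ _).
- move=> k /occurs_translate[[m /(name_inj wl)//]|[c cs /(name_inj wl) cE]].
  by apply: (@psubwit_irr (Wit a x s)); exists k; rewrite {1}cE.
- move=> /translate_ge; move: wK; rewrite /= geq_max => /andP[xK _].
  by rewrite leqNgt xK.
- apply: proves_sub h => th [|[b [y [s' [bl ->]]]]]; first by do 2 left.
  have [wE|wE] := pselect (Wit b y s' = Wit a x s).
    by right; case: wE => -> -> ->; rewrite {2}/inst translate_modify.
  by left; right; exists b, y, s'; split=> //; apply/drop_wit_In.
Qed.

Lemma forced_consistent : consistent G -> ~ forced (fun=> FOne).
Proof.
move=> Gcons [l [K0 h]]; apply: Gcons => phi; apply: proves_FOne.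
have [K1 lK1] := wbound_le l; pose K := maxn 1 (maxn K0 K1).
have : proves (par_hyps K (name K l)) FOne.
  apply: (@eliminate_witnesses K l l) => //; last first.
    apply: h; [rewrite /K; lia | exact: List.incl_refl].
  by move=> w /lK1 wK; rewrite /K; lia.
(* What remains is a refutation of finitely many formulas of [G] with their free variables shifted
   by [K + (size l).+1]; undoing the shift refutes [G]. *)
move=> /finite_deduction[m mG hm].
apply: (@foldl_proves _ _ _ m) => [psi /mG[]//|].
apply: (@proves_sub _ _ set0) => //; apply: (@unshift _ _ (K + (size l).+1)).
  apply: bound_foldl => [|psi /mG[_ psiK]]; first by rewrite /=; lia.
  exact: leq_trans psiK (leq_addr _ _).
by rewrite psubst_foldl psubst_FOne.
Qed.


Lemma forced_hyp phi : G phi -> forced (inst phi Par).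
Proof.
by move=> Gphi; exists [::], (bound phi) => K l phiK _; apply: proves_hyp;
  left; exists phi.
Qed.

(** An instance of (A8) once [K] exceeds the bound variables, since all translated terms then only
    contain variables from [K] on. *)
Lemma forced_le_Sup a x s c :
  forced (pdot (inst a [eta s with x |-> c]) (inst (Sup x a) s)).
Proof.
exists [::], (bound (Sup x a)) => K l aK _; apply: proves_axiom.
move: aK; rewrite /= geq_max => /andP[xK aK].
rewrite /pdot /inst [psubst _ (Sup x a)]/=.
rewrite translate_modify -(@subst_psubst _ _ x (translate (name K l) c)
  [eta (fun n => translate (name K l) (s n)) with x |-> Var x]).
- apply/A8/correct_subst_bound => y; rewrite bound_psubst => ya /translate_ge.
  by rewrite leqNgt (leq_trans ya aK).
- move=> n _ /=; case: eqP => _ /=; first by rewrite eqxx.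
  by rewrite subst_term_id// => /translate_ge; rewrite leqNgt xK.
- right=> n nx /=; case: eqP => // _ /translate_ge.
  by rewrite leqNgt xK.
Qed.

Lemma forced_Sup_le a x s :
  forced (pdot (inst (Sup x a) s) (inst a [eta s with x |-> Wit a x s])).
Proof.
exists [:: Wit a x s], 0%N => K l _ wl; apply: proves_hyp; right.
by exists a, x, s; split=> //; apply: wl; left.
Qed.

(** * The structure on closed terms with witnesses *)

Context (G_consistent : consistent G).

Lemma pformula_valuation : exists v : pformula -> R,
  [/\ forall p, 0 <= v p <= 1,
      forall p q, v (pdot p q) = Num.max (v p - v q) 0,
      forall p, v (pneg p) = 1 - v p,
      forall p, v (phalf p) = v p / 2 &
      forall p, forced p -> v p = 0].
Proof.
apply: (exists_valuation (zero := pzero) _ forced_theory).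
exact: forced_consistent.
Qed.

Definition pvalue : pformula -> R := projT1 (cid pformula_valuation).

Lemma pvalue01 p : 0 <= pvalue p <= 1.
Proof. by rewrite /pvalue; case: cid => v []. Qed.

Lemma pvalue_dot p q : pvalue (pdot p q) = Num.max (pvalue p - pvalue q) 0.
Proof. by rewrite /pvalue; case: cid => v []. Qed.

Lemma pvalue_neg p : pvalue (pneg p) = 1 - pvalue p.
Proof. by rewrite /pvalue; case: cid => v []. Qed.

Lemma pvalue_half p : pvalue (phalf p) = pvalue p / 2.
Proof. by rewrite /pvalue; case: cid => v []. Qed.

Lemma pvalue_forced p : forced p -> pvalue p = 0.
Proof. by rewrite /pvalue; case: cid => v [_ _ _ _ h] /=; exact: h. Qed.

Lemma pvalue_le p q : forced (pdot p q) -> pvalue p <= pvalue q.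
Proof. by move/pvalue_forced; rewrite pvalue_dot; case: max0P; lra. Qed.

Lemma pvalue_dform (e : dexp) : pvalue (fun=> dform e) = dval e.
Proof.
elim: e => [|a IHa b IHb|a IHa|a IHa] /=.
- rewrite -[LHS]/(pvalue (pneg (pdot pzero pzero))).
  by rewrite pvalue_neg pvalue_dot subrr maxxx subr0.
- by rewrite -IHa -IHb -pvalue_dot.
- by rewrite -IHa -pvalue_neg.
- by rewrite -IHa -pvalue_half.
Qed.

Lemma pvalue_FDyad (q : R) : dyadic q -> pvalue (fun=> FDyad q) = q.
Proof. by move=> dq; rewrite pvalue_dform dval_dyadic_name. Qed.

Definition wrel (P : rel_symb L) (cs : 'I_(rel_arity P) -> wterm) : R :=
  pvalue (fun nu => Atom (fun i => translate nu (cs i))).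

Definition pdistance d c e : pformula :=
  fun nu => distance d (translate nu c) (translate nu e).

Lemma wrel_distance d c e :
  @wrel d (pair_args c e) = pvalue (pdistance d c e).
Proof.
congr pvalue; apply/funext => nu; congr Atom; apply/funext => i.
by rewrite /pair_args; case: ifP.
Qed.

(** If [p] exceeded [eps], a dyadic [q] between the distance and [delta] and a dyadic [r] between
    [eps] and [p] would make both members of the forced conjunction positive. *)
Lemma modulus_le d c e (p : pformula) (eps delta : R) :
  0 < eps -> delta <= 1 ->
  (forall q r, dyadic q -> dyadic r -> eps < r -> q < delta ->
    forced (pdot (pdot (fun=> FDyad q) (pdistance d c e))
      (pdot (pdot (fun=> FDyad q) (pdistance d c e)) (pdot p (fun=> FDyad r))))) ->
  pvalue (pdistance d c e) < delta -> pvalue p <= eps.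
Proof.
move=> eps0 delta1 h cd; have /andP[d0 _] := pvalue01 (pdistance d c e).
have /andP[_ p1] := pvalue01 p.
have [q dq /andP[dq1 dq2]] := dyadic_between d0 cd delta1.
rewrite leNgt; apply/negP => epsp.
have [r dr /andP[epsr rp]] := dyadic_between (ltW eps0) epsp p1.
have := pvalue_forced (h q r dq dr epsr dq2).
rewrite !pvalue_dot !pvalue_FDyad//.
by do ![case: max0P]; move=> *; lra.
Qed.

Definition wstructure : prestructure L.
Proof.
refine (@Prestructure R L wterm (squash (Par 0)) CApp wrel _ _ _ _ _ _).
- by move=> P cs; exact: pvalue01.
- move=> d dL c; rewrite wrel_distance; apply/pvalue_forced/forced_proves => nu H.
  exact: distance_refl.
- move=> d dL c e; rewrite !wrel_distance; apply/eqP.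
  by rewrite eq_le !pvalue_le//; apply: forced_proves => nu H; exact: distance_sym.
- move=> d dL c e g; rewrite !wrel_distance.
  have : pvalue (pdot (pdot (pdistance d c g) (pdistance d c e))
      (pdistance d e g)) = 0.
    by apply/pvalue_forced/forced_proves => nu H; exact: distance_triangle.
  rewrite !pvalue_dot; case/andP: (pvalue01 (pdistance d e g)).
  by do ![case: max0P]; move=> *; lra.
- move=> d dL f i cs c e eps eps01; rewrite !wrel_distance.
  have /andP[eps0 _] := eps01; have /andP[_ mod1] := fun_mod01 (ltn_ord i) eps01.
  apply: (modulus_le eps0 mod1) => q r dq dr epsr qd.
  apply: forced_proves => nu H.
  have := @fun_modulus _ _ H d f i (fun j => translate nu (cs j)) (translate nu c)
    (translate nu e) eps r q dL eps01 dr dq epsr qd.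
  by rewrite -!translate_modify.
- move=> d dL P i cs c e eps eps01; rewrite wrel_distance => cd.
  have /andP[eps0 _] := eps01; have /andP[_ mod1] := rel_mod01 (ltn_ord i) eps01.
  rewrite -pvalue_dot; apply: (modulus_le eps0 mod1) cd => q r dq dr epsr qd.
  apply: forced_proves => nu H.
  have := @rel_modulus _ _ H d P i (fun j => translate nu (cs j)) (translate nu c)
    (translate nu e) eps r q dL eps01 dr dq epsr qd.
  by rewrite -!translate_modify.
Defined.

Lemma translate_value nu s (t : term L) :
  translate nu (term_value (M := wstructure) s t) =
  psubst_term (fun n => translate nu (s n)) t.
Proof. by elim: t => [//|f ts IH] /=; congr App; apply/funext. Qed.

(** The truth lemma. For a supremum, every instance is forced below it, and the instance at
    [Wit a x s] is forced to reach it. *)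
Lemma value_inst s phi : value (M := wstructure) s phi = pvalue (inst phi s).
Proof.
elim: phi s => [P ts|a IHa b IHb|a IHa|a IHa|x a IHa] s.
- congr pvalue; apply/funext => nu /=; congr Atom; apply/funext => i.
  exact: translate_value.
- by rewrite value_Dot IHa IHb -pvalue_dot.
- by rewrite /= IHa -pvalue_neg.
- by rewrite /= IHa -pvalue_half.
- apply/eqP; rewrite eq_le; apply/andP; split.
    apply: value_Sup_le => m; rewrite IHa.
    by apply: pvalue_le; exact: forced_le_Sup.
  apply: le_trans (value_le_Sup (M := wstructure) s x a (Wit a x s)).
  by rewrite IHa; apply: pvalue_le; exact: forced_Sup_le.
Qed.

Lemma wstructure_models : models (M := wstructure) Par G.
Proof.
by move=> phi Gphi; rewrite value_inst; apply/pvalue_forced/forced_hyp.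
Qed.

End ModelExistence.

Theorem theorem9p4 (R : realType) (L : signature R) (G : set (formula L))
    (G_consistent : consistent G) :
  exists (Lc : signature R) (h : sig_ext L Lc) (D : set (formula Lc))
         (M : prestructure Lc) (s : nat -> carrier M),
    [/\ maximal_consistent D, henkin_complete D,
        emb_formula h @` G `<=` D & models s D].
Proof. exact: henkin_of_model (wstructure_models G_consistent). Qed.
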